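(* Let $\mathbf n=(n_1,\ldots,n_k)\in\mathbb N^k$ with $n_i\ge2$ for all $i$, and let $\mathcal M\subseteq F^2(H_{n_1})\otimes\cdots\otimes F^2(H_{n_k})$ be an invariant subspace. Then $\mathcal M$ is graded and has positive defect operator $\Delta_{\mathcal M}$ if and only if there is a sequence of multi-homogeneous polynomials $\{\psi_s\}_{s=1}^N$, where $N\in\mathbb N$ or $N=\infty$, with the following properties: (i) each $\psi_s$ is in the range of $\Delta_{\mathcal M}$; (ii) $\{\widetilde\psi_s(\mathbf R_{i,j})\}_{s=1}^N$ are isometries with orthogonal ranges, where $\{\mathbf R_{i,j}\}$ is the right universal model; (iii) the orthogonal projection $P_{\mathcal M}$ satisfies the relation $$P_{\mathcal M}=\sum_{s=1}^N\widetilde\psi_s(\mathbf R_{i,j})\widetilde\psi_s(\mathbf R_{i,j})^*,$$ where the convergence is in the strong operator topology. Moreover, in this case, $N=\mathrm{rank}(\Delta_{\mathcal M})$ and $$\Delta_{\mathcal M}\xi=\sum_{s=1}^N\langle\xi,\psi_s\rangle\psi_s,\qquad\xi\in\bigotimes_{i=1}^kF^2(H_{n_i}).$$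
   Context: $H_{n_i}$ is an $n_i$-dimensional complex Hilbert space with orthonormal basis $e^i_1,\ldots,e^i_{n_i}$, and the full Fock space $F^2(H_{n_i}):=\mathbb C1\oplus\bigoplus_{p\ge1}H_{n_i}^{\otimes p}$ has orthonormal basis $e^i_\alpha:=e^i_{j_1}\otimes\cdots\otimes e^i_{j_p}$ for words $\alpha=g^i_{j_1}\cdots g^i_{j_p}$ in the unital free semigroup $\mathbb F_{n_i}^+$ on generators $g^i_1,\ldots,g^i_{n_i}$ (with $e^i_{g^i_0}:=1$ for the identity $g_0^i$); $|\alpha|$ is word length. Left and right creation operators on $F^2(H_{n_i})$: $S_{i,j}e^i_\alpha:=e^i_{g^i_j\alpha}$, $R_{i,j}e^i_\alpha:=e^i_{\alpha g^i_j}$. $\mathbf S_{i,j}$, $\mathbf R_{i,j}$ act on $\bigotimes_{i=1}^kF^2(H_{n_i})$ as $S_{i,j}$, respectively $R_{i,j}$, on the $i$-th factor and as the identity on the others; $\{\mathbf R_{i,j}\}$ is the right universal model. Subspaces are closed, and invariant means invariant under each $\mathbf S_{i,j}$. $\Phi_{\mathbf S_i}(Y):=\sum_{j=1}^{n_i}\mathbf S_{i,j}Y\mathbf S_{i,j}^*$; with $P_{\mathcal M}$ the orthogonal projection onto $\mathcal M$, the defect operator of $\mathcal M$ is $\Delta_{\mathcal M}:=(id-\Phi_{\mathbf S_1})\circ\cdots\circ(id-\Phi_{\mathbf S_k})(P_{\mathcal M})$; positive means $\Delta_{\mathcal M}\ge0$. The canonical gauge group $U:\mathbb T^k\to B(\bigotimes_{i=1}^kF^2(H_{n_i}))$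 ($\mathbb T$ the unit circle) is the unitary representation determined by $U(\lambda)(e^1_{\alpha_1}\otimes\cdots\otimes e^k_{\alpha_k})=\lambda_1^{|\alpha_1|}\cdots\lambda_k^{|\alpha_k|}e^1_{\alpha_1}\otimes\cdots\otimes e^k_{\alpha_k}$, $\lambda=(\lambda_1,\ldots,\lambda_k)$. $\mathcal M$ is graded if $U(\lambda)\mathcal M\subseteq\mathcal M$ for all $\lambda\in\mathbb T^k$. A polynomial is multi-homogeneous of order $(s_1,\ldots,s_k)\in\mathbb Z_+^k$ if it has the form $\sum_{|\alpha_i|=s_i}a_{\alpha_1,\ldots,\alpha_k}e^1_{\alpha_1}\otimes\cdots\otimes e^k_{\alpha_k}$; different $\psi_s$ may have different orders. For a polynomial $f=\sum a_{\beta_1,\ldots,\beta_k}e^1_{\beta_1}\otimes\cdots\otimes e^k_{\beta_k}$ (finite sum), $\widetilde f(\mathbf R_{i,j}):=\sum a_{\beta_1,\ldots,\beta_k}\mathbf R_{1,\widetilde\beta_1}\cdots\mathbf R_{k,\widetilde\beta_k}$, where $\widetilde\beta=g^i_{j_p}\cdots g^i_{j_1}$ is the reverse of $\beta=g^i_{j_1}\cdots g^i_{j_p}$ and $\mathbf R_{i,\beta}:=\mathbf R_{i,j_1}\cdots\mathbf R_{i,j_p}$ ($\mathbf R_{i,g_0^i}:=I$). *)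

(* Defs.v *)
From HB Require Import structures.
From mathcomp Require Import all_boot all_order all_algebra complex.
From mathcomp Require Import sesquilinear.
From mathcomp Require Import all_classical all_reals ereal topology normedtype.
From mathcomp Require Import numfun esum.
From mathcomp Require Import ring lra.

Set Implicit Arguments.
Unset Strict Implicit.
Unset Printing Implicit Defensive.

Import Order.TTheory GRing.Theory Num.Theory.
Import ComplexField.Normc.

Local Open Scope classical_set_scope.
Local Open Scope ring_scope.
Local Open Scope complex_scope.

Section real_sums.
Context {R : realType} {I : choiceType}.
Implicit Types a b : I -> R.

Definition rsum a : R :=
  fine (\esum_(i in setT) ((EFin \o a)^\+)%E i
        - \esum_(i in setT) ((EFin \o a)^\-)%E i)%E.

Definition rsummable a := summable setT (EFin \o a).

Lemma rsummable_le a b : (forall i, `|a i| <= `|b i|) ->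
  rsummable b -> rsummable a.
Proof.
move=> leab; apply: le_lt_trans; apply: le_esum => i _ /=.
by rewrite lee_fin.
Qed.

Lemma rsummableD a b : rsummable a -> rsummable b -> rsummable (a \+ b).
Proof. exact: summableD. Qed.

Lemma esumZ (c : R) a : 0 <= c -> (forall i, 0 <= a i) ->
  (\esum_(i in setT) (c * a i)%:E = c%:E * \esum_(i in setT) (a i)%:E)%E.
Proof.
move=> c0 a0; rewrite /esum -ereal_supZl//; last first.
  by apply/set0P; exists (\sum_(i \in set0) (a i)%:E)%E, set0 => //; split.
congr ereal_sup; apply/seteqP; split => [_ [A hA <-]|_ [_ [A hA <-] <-]].
  exists (\sum_(i \in A) (a i)%:E)%E; first by exists A.
  by rewrite ge0_mule_fsumr// => i; rewrite lee_fin.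
by exists A => //; rewrite ge0_mule_fsumr// => i; rewrite lee_fin.
Qed.

Lemma rsummableZ (c : R) a : rsummable a -> rsummable (fun i => c * a i).
Proof.
move=> sa; rewrite /rsummable /summable/=.
under eq_esum do rewrite normrM.
rewrite esumZ//; move: sa; rewrite /rsummable summableE => /fineK/= <-.
exact: ltry.
Qed.

Definition psum a : R := fine (\esum_(i in setT) (a i)%:E).

Lemma psumK a : (forall i, 0 <= a i) -> rsummable a ->
  (psum a)%:E = \esum_(i in setT) (a i)%:E.
Proof.
move=> a0; rewrite /rsummable summableE/=.
by under eq_esum do rewrite ger0_norm//; move/fineK.
Qed.

Lemma rsumB a b : (forall i, 0 <= a i) -> (forall i, 0 <= b i) ->
  rsummable a -> rsummable b -> rsum (a \- b) = psum a - psum b.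
Proof.
move=> a0 b0 sa sb; have := esumB sa sb.
rewrite /rsum => -> //; try by move=> i _; rewrite lee_fin.
by rewrite -!psumK.
Qed.

Lemma psumD a b : (forall i, 0 <= a i) -> (forall i, 0 <= b i) ->
  rsummable a -> rsummable b -> psum (a \+ b) = psum a + psum b.
Proof.
move=> a0 b0 sa sb; apply: EFin_inj; rewrite EFinD !psumK//.
- by rewrite -esumD => [//|i _|i _]; rewrite lee_fin.
- by move=> i; rewrite addr_ge0.
- exact: rsummableD.
Qed.

Lemma psumZ (c : R) a : 0 <= c -> (forall i, 0 <= a i) -> rsummable a ->
  psum (fun i => c * a i) = c * psum a.
Proof.
move=> c0 a0 sa; apply: EFin_inj; rewrite EFinM !psumK ?esumZ//.
- by move=> i; rewrite mulr_ge0.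
- exact: rsummableZ.
Qed.

Definition rpos a i := (`|a i| + a i) / 2.
Definition rneg a i := (`|a i| - a i) / 2.

Lemma rpos_ge0 a i : 0 <= rpos a i.
Proof. by rewrite /rpos; have := ler_norm (- a i); rewrite normrN; lra. Qed.

Lemma rneg_ge0 a i : 0 <= rneg a i.
Proof. by rewrite /rneg; have := ler_norm (a i); lra. Qed.

Lemma rposneg a : a = rpos a \- rneg a.
Proof. by apply/funext => i; rewrite /rpos /rneg/=; lra. Qed.

Lemma rsummable_pos a : rsummable a -> rsummable (rpos a).
Proof.
apply: rsummable_le => i; rewrite ger0_norm ?rpos_ge0//.
by rewrite /rpos; have := ler_norm (a i); lra.
Qed.

Lemma rsummable_neg a : rsummable a -> rsummable (rneg a).
Proof.
apply: rsummable_le => i; rewrite ger0_norm ?rneg_ge0//.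
by rewrite /rneg; have := ler_norm (- a i); rewrite normrN; lra.
Qed.

Lemma rsumE a : rsummable a -> rsum a = psum (rpos a) - psum (rneg a).
Proof.
move=> sa; rewrite [in LHS](rposneg a) rsumB//.
- exact: rpos_ge0.
- exact: rneg_ge0.
- exact: rsummable_pos.
- exact: rsummable_neg.
Qed.

Local Hint Resolve rpos_ge0 rneg_ge0 rsummable_pos rsummable_neg : core.

Lemma rsumD a b : rsummable a -> rsummable b ->
  rsum (a \+ b) = rsum a + rsum b.
Proof.
move=> sa sb; rewrite (rsumE sa) (rsumE sb).
have -> : a \+ b = (rpos a \+ rpos b) \- (rneg a \+ rneg b).
  by apply/funext => i; rewrite /rpos /rneg/=; lra.
rewrite rsumB ?psumD; [ring|..]; auto.
- by move=> i; rewrite addr_ge0.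
- by move=> i; rewrite addr_ge0.
- by apply: rsummableD; auto.
- by apply: rsummableD; auto.
Qed.

Lemma rsumN a : rsummable a -> rsum (\- a) = - rsum a.
Proof.
move=> sa; rewrite (rsumE sa).
have -> : \- a = rneg a \- rpos a.
  by apply/funext => i; rewrite /rpos /rneg/=; lra.
by rewrite rsumB ?opprB; auto.
Qed.

Lemma rsumZ (c : R) a : rsummable a -> rsum (fun i => c * a i) = c * rsum a.
Proof.
wlog c0 : c / 0 <= c => [hw sa|sa].
  have [c0|c0] := leP 0 c; first exact: hw.
  have -> : (fun i => c * a i) = \- (fun i => - c * a i).
    by apply/funext => i /=; ring.
  rewrite rsumN; last exact: rsummableZ.
  by rewrite hw//; [ring|lra].
rewrite (rsumE sa).
have -> : (fun i => c * a i) =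
    (fun i => c * rpos a i) \- (fun i => c * rneg a i).
  by apply/funext => i; rewrite /rpos /rneg/=; lra.
rewrite rsumB ?psumZ; [ring|..]; auto.
- by move=> i; rewrite mulr_ge0.
- by move=> i; rewrite mulr_ge0.
- by apply: rsummableZ; auto.
- by apply: rsummableZ; auto.
Qed.

Lemma rsum_ge0E a : (forall i, 0 <= a i) -> rsummable a -> rsum a = psum a.
Proof.
move=> a0 sa; rewrite rsumE//.
have -> : rpos a = a.
  by apply/funext => i; rewrite /rpos ger0_norm//; lra.
have -> : rneg a = cst 0.
  by apply/funext => i; rewrite /rneg ger0_norm//= subrr mul0r.
by rewrite /psum [X in _ - fine X]esum1// subr0.
Qed.

Lemma psum_term a j : (forall i, 0 <= a i) -> rsummable a -> a j <= psum a.
Proof.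
move=> a0 sa; rewrite -lee_fin psumK//.
rewrite (esumID [set j])//; last by move=> i _; rewrite lee_fin.
rewrite setTI esum_set1; last by rewrite lee_fin.
by rewrite leeDl//; apply: esum_ge0 => i _; rewrite lee_fin.
Qed.

End real_sums.

Section complex_sums.
Context {R : realType} {I : choiceType}.
Implicit Types (a b : I -> R[i]).

(* Only meaningful for absolutely summable families. *)
Definition csum a : R[i] :=
  rsum (fun i => complex.Re (a i)) +i* rsum (fun i => complex.Im (a i)).

Definition csummable a := rsummable (fun i => normc (a i)).

Lemma normc_ge0 (z : R[i]) : 0 <= normc z.
Proof. by case: z => x y; exact: sqrtr_ge0. Qed.

Lemma normcE2 (z : R[i]) :
  normc z ^+ 2 = complex.Re z ^+ 2 + complex.Im z ^+ 2.
Proof. by case: z => x y /=; rewrite sqr_sqrtr// addr_ge0 ?sqr_ge0. Qed.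

Lemma normc_conj (z : R[i]) : normc z^* = normc z.
Proof. by case: z => x y /=; rewrite sqrrN. Qed.

Lemma Re_le_normc (z : R[i]) : `|complex.Re z| <= normc z.
Proof.
rewrite -(@ler_pXn2r _ 2)// ?nnegrE ?normc_ge0// normcE2 real_normK ?num_real//.
by rewrite lerDl sqr_ge0.
Qed.

Lemma Im_le_normc (z : R[i]) : `|complex.Im z| <= normc z.
Proof.
rewrite -(@ler_pXn2r _ 2)// ?nnegrE ?normc_ge0// normcE2 real_normK ?num_real//.
by rewrite lerDr sqr_ge0.
Qed.

Lemma csummable_Re a : csummable a -> rsummable (fun i => complex.Re (a i)).
Proof.
by apply: rsummable_le => i; rewrite [leRHS]ger0_norm ?normc_ge0 ?Re_le_normc.
Qed.

Lemma csummable_Im a : csummable a -> rsummable (fun i => complex.Im (a i)).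
Proof.
by apply: rsummable_le => i; rewrite [leRHS]ger0_norm ?normc_ge0 ?Im_le_normc.
Qed.

Local Hint Resolve csummable_Re csummable_Im : core.

Lemma csumD a b : csummable a -> csummable b ->
  csum (fun i => a i + b i) = csum a + csum b.
Proof.
move=> sa sb; rewrite /csum /GRing.add/=; congr (_ +i* _).
- rewrite -rsumD; auto.
  by congr rsum; apply/funext => i /=; case: (a i); case: (b i).
- rewrite -rsumD; auto.
  by congr rsum; apply/funext => i /=; case: (a i); case: (b i).
Qed.

Lemma csumZ (z : R[i]) a : csummable a ->
  csum (fun i => z * a i) = z * csum a.
Proof.
case: z => x y sa.
have [sr si] := (csummable_Re sa, csummable_Im sa).
have ZRe c := rsummableZ c sr; have ZIm c := rsummableZ c si.
have NIm : rsummable (\- (fun i => y * complex.Im (a i))).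
  by apply: rsummable_le (ZIm y) => i /=; rewrite normrN.
rewrite /csum; apply/eqP; rewrite eq_complex/=; apply/andP; split; apply/eqP.
- rewrite -!rsumZ// -rsumN// -rsumD//.
  by congr rsum; apply/funext => i /=; case: (a i).
- rewrite -!rsumZ// -rsumD//.
  by congr rsum; apply/funext => i /=; case: (a i).
Qed.

Lemma csum_conj a : csummable a -> csum (fun i => (a i)^*) = (csum a)^*.
Proof.
move=> sa; rewrite /csum/= -rsumN; auto; congr (_ +i* _).
- by congr rsum; apply/funext => i; case: (a i).
- by congr rsum; apply/funext => i /=; case: (a i).
Qed.

End complex_sums.

Section square_summable.
Context (R : realType) (I : choiceType).
Implicit Types f g : I -> R[i].

Definition square_summable : {pred I -> R[i]} :=
  [pred f | `[< rsummable (fun i => normc (f i) ^+ 2) >]].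

Lemma square_summableP f :
  reflect (rsummable (fun i => normc (f i) ^+ 2)) (f \in square_summable).
Proof. exact: asboolP. Qed.

Lemma normc_sqrD (z w : R[i]) :
  normc (z + w) ^+ 2 <= 2 * normc z ^+ 2 + 2 * normc w ^+ 2.
Proof.
rewrite !normcE2; case: z => x y; case: w => u v /=.
have := sqr_ge0 (x - u); have := sqr_ge0 (y - v); nra.
Qed.

Fact square_summable_submod_closed : submod_closed square_summable.
Proof.
split=> [|z f g /square_summableP sf /square_summableP sg].
  apply/square_summableP; apply: (@rsummable_le _ _ _ (cst 0)) => [i|].
    by rewrite normc0 expr0n.
  rewrite /rsummable /summable esum1 ?ltry// => i _.
  by rewrite /= normr0.
apply/square_summableP.
apply: (@rsummable_le _ _ _
  (fun i => (2 * normc z ^+ 2) * normc (f i) ^+ 2 + 2 * normc (g i) ^+ 2)).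
  move=> i; rewrite !ger0_norm ?sqr_ge0//; last first.
    by rewrite addr_ge0// mulr_ge0 ?sqr_ge0// mulr_ge0 ?sqr_ge0.
  apply: le_trans (normc_sqrD _ _) _.
  by rewrite [X in normc X]/GRing.scale/= normcM exprMn mulrA.
by apply: rsummableD; exact: rsummableZ.
Qed.

HB.instance Definition _ := GRing.isSubmodClosed.Build _ _ square_summable
  square_summable_submod_closed.

Record l2 := L2 { l2_val :> I -> R[i] ; l2_valP : l2_val \in square_summable }.

HB.instance Definition _ := [isSub for l2_val].
HB.instance Definition _ := [Choice of l2 by <:].
HB.instance Definition _ := [SubChoice_isSubLmodule of l2 by <:].

Lemma l2P (u v : l2) : u =1 v -> u = v.
Proof. by move=> uv; apply/val_inj/funext. Qed.

Lemma l2_summable (u : l2) : rsummable (fun i => normc (u i) ^+ 2).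
Proof. exact/square_summableP/l2_valP. Qed.

Definition dot (u v : l2) : R[i] := csum (fun i => u i * (v i)^*).

Lemma dot_summable (u v : l2) : csummable (fun i => u i * (v i)^*).
Proof.
apply: (@rsummable_le _ _ _ (fun i => normc (u i) ^+ 2 + normc (v i) ^+ 2)).
  move=> i; rewrite normcM normc_conj !ger0_norm ?addr_ge0 ?sqr_ge0//; last first.
    by rewrite mulr_ge0 ?normc_ge0.
  by have := sqr_ge0 (normc (u i) - normc (v i));
    have := normc_ge0 (u i); have := normc_ge0 (v i); nra.
by apply: rsummableD; exact: l2_summable.
Qed.

Lemma dotPl z (u v w : l2) : dot (z *: u + v) w = z * dot u w + dot v w.
Proof.
rewrite /dot -csumZ; last exact: dot_summable.
rewrite -csumD; last exact: dot_summable.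
  by congr csum; apply/funext => i; rewrite mulrA -mulrDl.
apply: (@rsummable_le _ _ _ (fun i => normc z * normc (u i * (w i)^*))).
  by move=> i; rewrite normcM.
by apply: rsummableZ; exact: dot_summable.
Qed.

Lemma dotC (u v : l2) : dot u v = (dot v u)^*.
Proof.
rewrite /dot -csum_conj; last exact: dot_summable.
by congr csum; apply/funext => i; rewrite rmorphM/= conjcK mulrC.
Qed.

Lemma dotPr z (u v w : l2) : dot u (z *: v + w) = z^* * dot u v + dot u w.
Proof. by rewrite dotC dotPl [dot u v]dotC [dot u w]dotC rmorphD rmorphM. Qed.

Lemma dot_gt0 (u : l2) : u != 0 -> 0 < dot u u.
Proof.
have sE i : u i * (u i)^* = (normc (u i) ^+ 2)%:C.
  case: (u i) => x y /=; rewrite sqr_sqrtr ?addr_ge0 ?sqr_ge0//.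
  by apply/eqP; rewrite eq_complex/=; apply/andP; split; apply/eqP; ring.
move=> /eqP u0; have [i ui0] : exists i, u i != 0.
  apply: contrapT => /forallNP h; apply: u0; apply: l2P => i.
  by have /negP := h i; rewrite negbK => /eqP.
have -> : dot u u = (psum (fun i => normc (u i) ^+ 2))%:C.
  rewrite /dot /csum.
  have -> : (fun i => complex.Re (u i * (u i)^*)) = (fun i => normc (u i) ^+ 2).
    by apply/funext => j; rewrite sE.
  have -> : (fun i => complex.Im (u i * (u i)^*)) = (fun i => 0).
    by apply/funext => j; rewrite sE.
  rewrite rsum_ge0E => [|j|]; [|exact: sqr_ge0|exact: l2_summable].
  congr (_ +i* _); rewrite rsum_ge0E//; first by rewrite /psum esum1.
  by apply: rsummable_le (l2_summable u) => j; rewrite normr0.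
rewrite ltcR; apply: (@lt_le_trans _ _ (normc (u i) ^+ 2)).
  rewrite lt_def sqr_ge0 andbT sqrf_eq0.
  by apply: contra ui0 => /eqP /eq0_normc ->.
by apply: psum_term (l2_summable u) => j; exact: sqr_ge0.
Qed.

End square_summable.

Arguments dot {R I}.

Section l2_hilbert.
Context {R : realType} {I : choiceType}.
Local Notation H := (l2 R I).
Local Notation C := R[i].

Fact dot_bilinear : bilinear_for (GRing.mul : GRing.Scale.law C C)
  ((Num.conj \; GRing.mul) : GRing.Scale.law C C) (@dot R I).
Proof. by split=> u z v w; [exact: dotPl|exact: dotPr]. Qed.

HB.instance Definition _ := @bilinear_isBilinear.Build C H H C _ _
  (@dot R I) dot_bilinear.

Fact dot_hermitian (u v : H) :
  dot u v = (-1) ^+ false * Num.conj (dot v u).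
Proof. by rewrite mul1r; exact: dotC. Qed.

HB.instance Definition _ := @isHermitianSesquilinear.Build C H false Num.conj
  (@dot R I) dot_hermitian.

HB.instance Definition _ := @isDotProduct.Build C H (@dot R I) (@dot_gt0 R I).

Definition l2norm (u : H) : C := sqrtC (dot u u).

Lemma l2norm_ge0 u : 0 <= l2norm u.
Proof. exact: sqrt_dnorm_ge0. Qed.

Lemma dot_CauchySchwarz (u v : H) : `|dot u v| <= l2norm u * l2norm v.
Proof.
have [->|v0] := eqVneq v 0.
  by rewrite linear0r normr0 mulr_ge0 ?l2norm_ge0.
rewrite -sqrtCM ?nnegrE ?dnorm_ge0// -(sqrCK (normr_ge0 _)).
rewrite ler_sqrtC ?nnegrE ?mulr_ge0 ?dnorm_ge0 ?exprn_ge0//.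
have vv : 0 < dot v v by rewrite dnorm_gt0.
pose a := dot u v / dot v v; pose w := u - a *: v.
have wv : dot w v = 0.
  by rewrite linearBl/= linearZl_LR/= divfK ?subrr// gt_eqF.
have -> : u = w + a *: v by rewrite subrK.
rewrite hnormDd; last by rewrite linearZr_LR/= wv mulr0.
rewrite linearDl/= wv add0r linearZl_LR/= normrM exprMn mulrDl dnormZ.
rewrite (ger0_norm (ltW vv)) expr2 mulrA lerDr.
by rewrite mulr_ge0// dnorm_ge0.
Qed.

Lemma l2normD u v : l2norm (u + v) <= l2norm u + l2norm v.
Proof.
rewrite -ler_sqr ?nnegrE ?addr_ge0 ?l2norm_ge0//.
rewrite sqrrD !sqrtCK addrAC dnormD lerD2l.
have -> : dot u v + (dot u v)^*%R = 'Re (dot u v) * 2.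
  by rewrite ReE divfK// pnatr_eq0.
rewrite -[leRHS]mulr_natr ler_pM2r ?ltr0n//.
exact: le_trans (leif_Re_Creal _).1 (dot_CauchySchwarz u v).
Qed.

Lemma l2normZ (z : C) u : l2norm (z *: u) = `|z| * l2norm u.
Proof.
by rewrite /l2norm dnormZ sqrtCM ?nnegrE ?exprn_ge0 ?dnorm_ge0// sqrCK.
Qed.

Lemma l2norm0_eq0 u : l2norm u = 0 -> u = 0.
Proof. by move/eqP; rewrite sqrt_dnorm_eq0 => /eqP. Qed.

HB.instance Definition _ := @Lmodule_isNormed.Build C H l2norm
  l2normD l2normZ l2norm0_eq0.

End l2_hilbert.

Section l2_operators.
Context {R : realType} {I : choiceType}.
Local Notation H := (l2 R I).
Local Notation C := R[i].
Implicit Types (T : H -> H) (M : set H).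

Fact basis_subproof (i : I) :
  (fun j => (j == i)%:R : C) \in @square_summable _ _.
Proof.
apply/square_summableP; rewrite /rsummable /summable (esumID [set i])//.
rewrite setTI esum_set1; last exact: abse_ge0.
rewrite esum1 ?adde0 ?ltry// => j [_ /eqP/negbTE] /= ->.
by rewrite normc0 expr0n normr0.
Qed.

Definition basis i : H := L2 (basis_subproof i).

(* Junk value 0 at y if the linear form x |-> dot (T x) y is unbounded. *)
Definition adj T : H -> H :=
  fun y => xget 0 [set z | forall x, dot (T x) y = dot x z].

(* Meaningful when M is a closed subspace. *)
Definition proj M : H -> H :=
  fun x => xget 0 [set p | M p /\ forall m, M m -> dot (x - p) m = 0].

(* 0 <= z in R[i] entails that z is real. *)
Definition positive T := forall x, 0 <= dot (T x) x.

Definition isometric T := forall x, `|T x| = `|x|.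

Definition orthogonal_ranges T T' := forall x y, dot (T x) (T' y) = 0.

Definition closed_subspace M :=
  [/\ M 0, forall (z : C) x y, M x -> M y -> M (z *: x + y) & closed M].

Definition lin_indep m (v : 'I_m -> H) :=
  forall c : 'I_m -> C, \sum_i c i *: v i = 0 -> forall i, c i = 0.

Definition dimension_is M m := exists v : 'I_m -> H,
  lin_indep v /\ M = range (fun c : 'I_m -> C => \sum_i c i *: v i).

(* None stands for infinity. *)
Definition rank T : option nat :=
  xget None [set Some m | m in [set m | dimension_is (range T) m]].

Definition index_lt (s : nat) (N : option nat) : bool :=
  if N is Some m then (s < m)%N else true.

(* l is the sum of x s over the indices s < N (in norm if N is infinite). *)
Definition sums_to (N : option nat) (x : nat -> H) (l : H) :=
  (fun m => \sum_(s < m | index_lt s N) x s) @ \oo --> l.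

Definition pushforward (h : I -> I) (f : I -> C) : I -> C :=
  fun j => \sum_(i \in h @^-1` [set j]) f i.

Lemma pushforwardE h f i : injective h -> pushforward h f (h i) = f i.
Proof.
move=> hI; rewrite /pushforward (_ : _ @^-1` _ = [set i]) ?fsbig_set1//.
by apply/seteqP; split=> [j /hI ->|j ->].
Qed.

Lemma pushforward_out h f j : ~ range h j -> pushforward h f j = 0.
Proof.
move=> hj; rewrite /pushforward (_ : _ @^-1` _ = set0) ?fsbig_set0//.
by apply/seteqP; split=> [i /= hij|//]; apply: hj; exists i.
Qed.

Fact shift_subproof h (u : H) : injective h ->
  pushforward h u \in @square_summable _ _.
Proof.
move=> hI; apply/square_summableP; have := l2_summable u.
rewrite /rsummable /summable => /(le_lt_trans _); apply.
rewrite (esumID (range h))// setTI esum_image; last by move=> ? ? _ _ /hI.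
rewrite [X in (_ + X)%E]esum1 => [|j [_ hj]]; last first.
  by rewrite /= pushforward_out// normc0 expr0n normr0.
by rewrite adde0; apply: le_esum => i _ /=; rewrite pushforwardE.
Qed.

Definition shift h (hI : injective h) (u : H) : H :=
  L2 (shift_subproof u hI).

Lemma shift_basis h (hI : injective h) i :
  shift hI (basis i) = basis (h i).
Proof.
apply: l2P => j /=; have [[i' _ <-]|hj] := pselect (range h j).
  by rewrite pushforwardE//= (inj_eq hI).
rewrite pushforward_out//; case: eqP => // ji.
by exfalso; apply: hj; exists i.
Qed.

End l2_operators.

Section Fock.
Context {R : realType} {k : nat} (n : 'I_k -> nat).
Local Notation C := R[i].

Definition word := {dffun forall i : 'I_k, seq 'I_(n i)}.

Definition word_set (w : word) (i : 'I_k) (a : seq 'I_(n i)) : word :=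
  finfun (dfwith w i a).

(* F^2(H_(n i)) is identified with l^2(seq 'I_(n i)) through its orthonormal
   basis of words, and the Hilbert space tensor product of these k spaces with
   l^2 of the product of their index sets: basis w is the elementary tensor
   e^1_(w 1) (x) ... (x) e^k_(w k). *)
Definition fock := l2 R word.

Definition lcons i (j : 'I_(n i)) (w : word) : word := word_set w (j :: w i).
Definition lrcons i (j : 'I_(n i)) (w : word) : word :=
  word_set w (rcons (w i) j).

Lemma word_set_inj i (a : word -> seq 'I_(n i)) :
  (forall v w : word, a v = a w -> v i = w i) ->
  injective (fun w => word_set w (a w)).
Proof.
move=> aI v w /ffunP vw; apply/ffunP => i'.
have := vw i'; rewrite !ffunE.
have [<-{i'}|ii'] := eqVneq i i'; first by rewrite !dfwithin => /aI.
by rewrite !dfwithout.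
Qed.

Fact lcons_inj i (j : 'I_(n i)) : injective (lcons j).
Proof. by apply: word_set_inj => v w []. Qed.

Fact lrcons_inj i (j : 'I_(n i)) : injective (lrcons j).
Proof. apply: (@word_set_inj i (fun w : word => rcons (w i) j)) => v w /=.
exact: rcons_injl. Qed.

Definition lcreate i (j : 'I_(n i)) : fock -> fock := shift (@lcons_inj i j).
Definition rcreate i (j : 'I_(n i)) : fock -> fock := shift (@lrcons_inj i j).

Lemma lcreate_basis i (j : 'I_(n i)) w :
  lcreate j (basis w) = basis (word_set w (j :: w i)).
Proof. exact: shift_basis. Qed.

Lemma rcreate_basis i (j : 'I_(n i)) w :
  rcreate j (basis w) = basis (word_set w (rcons (w i) j)).
Proof. exact: shift_basis. Qed.

Definition invariant_subspace (M : set fock) :=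
  closed_subspace M /\
  forall i (j : 'I_(n i)) f, M f -> M (lcreate j f).

Definition Phi i (Y : fock -> fock) : fock -> fock :=
  fun f => \sum_(j < n i) lcreate j (Y (adj (lcreate j) f)).

Definition defect (M : set fock) : fock -> fock :=
  (\big[comp/id]_(i < k) (fun Y => Y \- Phi i Y)) (proj M).

Definition circle := {z : C | `|z| == 1}.

Definition gauge_weight (lam : 'I_k -> circle) (w : word) : C :=
  \prod_(i < k) val (lam i) ^+ size (w i).

Fact gauge_subproof lam (f : fock) :
  (fun w => gauge_weight lam w * f w) \in @square_summable _ _.
Proof.
apply/square_summableP.
rewrite (_ : (fun i => _) = (fun w => normc (f w) ^+ 2)); first exact: l2_summable.
apply/funext => w; rewrite normcM (_ : normc _ = 1) ?mul1r//.
apply: complexI; rewrite -[LHS]/`|gauge_weight lam w| normr_prod big1// => i _.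
by rewrite normrX (eqP (valP (lam i))) expr1n.
Qed.

Definition gauge lam (f : fock) : fock := L2 (gauge_subproof lam f).

Lemma gauge_basis lam w :
  gauge lam (basis w) = (\prod_(i < k) val (lam i) ^+ size (w i)) *: basis w.
Proof.
apply: l2P => v; rewrite -[LHS]/(gauge_weight lam v * (v == w)%:R).
rewrite -[RHS]/(gauge_weight lam w * (v == w)%:R).
by case: eqP => [->//|_]; rewrite !mulr0.
Qed.

Definition graded (M : set fock) :=
  forall lam f, M f -> M (gauge lam f).

(* The words w with size (w i) = s i for all i are indexed by families of
   tuples. *)
Definition homogeneous_of (s : 'I_k -> nat) (f : fock) :=
  exists a : {dffun forall i : 'I_k, (s i).-tuple 'I_(n i)} -> C,
    f = \sum_t a t *: basis (finfun (fun i => tval (t i)) : word).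

Definition multi_homogeneous (f : fock) := exists s, homogeneous_of s f.

Definition rcreate_word i (b : seq 'I_(n i)) : fock -> fock :=
  foldr (fun j T => rcreate j \o T) id b.

(* Meant for polynomials f, i.e. finitely supported f: the sum has the junk
   value 0 if infinitely many of its terms are nonzero. *)
Definition tilde_R (f : fock) : fock -> fock :=
  fun x => \sum_(w \in [set w : word | f w != 0])
    f w *: (\big[comp/id]_(i < k) rcreate_word (rev (w i))) x.

Definition homogeneous_model (M : set fock) (N : option nat)
    (psi : nat -> fock) :=
  [/\ forall s, index_lt s N -> multi_homogeneous (psi s),
      forall s, index_lt s N -> range (defect M) (psi s),
      forall s, index_lt s N -> isometric (tilde_R (psi s)),
      forall s t, index_lt s N -> index_lt t N -> s <> t ->
        orthogonal_ranges (tilde_R (psi s)) (tilde_R (psi t)) &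
      forall x, sums_to N (fun s => tilde_R (psi s) (adj (tilde_R (psi s)) x))
                  (proj M x)].

End Fock.

Arguments fock R {k} n.

(* Main.v *)
Require Import Defs.
From HB Require Import structures.
From mathcomp Require Import all_boot all_order all_algebra complex.
From mathcomp Require Import sesquilinear.
From mathcomp Require Import all_classical all_reals ereal topology normedtype.
From mathcomp Require Import finmap numfun esum.
From mathcomp Require Import ring lra.

Import Order.TTheory GRing.Theory Num.Theory.
Import ComplexField.Normc numFieldNormedType.Exports.
Local Open Scope classical_set_scope.
Local Open Scope ring_scope.

(** Write P for the projection onto M, Delta for its defect operator and, for a
    polynomial f, G_f for the right multiplier [tilde_R f].

    Everything rests on two properties of the map Y |-> Y - Phi_i(Y).  It is
    order reflecting: as <Phi_i(Y)x, x> is the sum of the <Y y, y> with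
    y = S_ij^* x, and S_ij^* lowers the i-th degree, positivity of Y - Phi_i(Y)
    on vectors of bounded degree gives positivity of Y there, by induction on
    the i-th degree ([positive_on_bounded_partial]).  It is also injective, and
    even reflects convergence on basis vectors, for the same reason
    ([partial_defect_basis_cvg0]).

    If M is graded, P and all its partial defects preserve multi-degrees.  If
    Delta is positive, so are all partial defects, and each of them is then a
    difference of two projections Q - Phi_i(Q) that is positive, hence a
    projection ([orth_projection_partial_defect]).  So Delta is a projection
    whose range is the closed span of homogeneous polynomials, and Gram-Schmidt applied
    to the images of the basis vectors produces an orthonormal basis psi_s of
    that range made of such polynomials ([graded_gram_schmidt]).

    The multipliers commute with left creation operators and the defect of the
    identity is the projection onto the vacuum, so G_f G_f^* has defect
    <., f> f ([defect_tilde_R]).  Hence the defect of P minus the m-th partial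
    sum of the G_s G_s^* is Delta minus a subprojection; it is positive, and by
    order reflection that partial sum is below P ([range_sum_le]).  Testing
    this on the unit vectors x = G_s e_w of M gives sum_t |G_t^* x|^2 <= 1,
    while G_s^* x already has coordinate 1 at w: therefore G_s^* x = e_w, and
    G_t^* x = 0 for t <> s ([tilde_R_orthonormal]).  This single inequality
    shows that the multipliers are isometries with orthogonal ranges.  The
    partial sums are then contractions, and they converge to P on basis vectors
    because their defects converge to Delta, hence strongly
    ([range_sum_cvg]).

    Conversely, applying the finite, strongly continuous recipe of the defect
    to P = sum_s G_s G_s^* gives Delta = sum_s <., psi_s> psi_s
    ([model_defect_expansion]), from which positivity and the rank are read
    off.  Since conjugation by a gauge unitary multiplies each G_s by a scalar,
    these unitaries preserve the ranges of the G_s and so M ([model_graded]). *)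

(** * Sums over index sets and the inner product *)

Section sums.
Set Implicit Arguments.
Unset Strict Implicit.
Local Open Scope complex_scope.
Context {R : realType} {I J : choiceType}.
Local Notation C := R[i].

Lemma esum_reindex (h : I -> J) (F : J -> \bar R) : injective h ->
  (forall j, 0 <= F j)%E -> (forall j, ~ range h j -> F j = 0)%E ->
  (\esum_(j in setT) F j = \esum_(i in setT) F (h i))%E.
Proof.
move=> hI F0 Fout; rewrite (esumID (range h))// setTI esum_image; last first.
  by move=> ? ? _ _ /hI.
by rewrite [X in (_ + X)%E]esum1 ?adde0// => j [_ /Fout].
Qed.

Lemma rsum_reindex (h : I -> J) (a : J -> R) : injective h ->
  (forall j, ~ range h j -> a j = 0) -> rsum a = rsum (a \o h).
Proof.
move=> hI aout; rewrite /rsum compA.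
rewrite (funepos_comp (EFin \o a) h) (funeneg_comp (EFin \o a) h).
rewrite (esum_reindex hI (funepos_ge0 _)) => [|j /aout aj0]; last first.
  by rewrite funeposE /= aj0 maxxx.
rewrite (esum_reindex hI (funeneg_ge0 _)) => [//|j /aout aj0].
by rewrite funenegE /= aj0 oppr0 maxxx.
Qed.

Lemma csum_reindex (h : I -> J) (a : J -> C) : injective h ->
  (forall j, ~ range h j -> a j = 0) -> csum a = csum (a \o h).
Proof.
move=> hI aout; rewrite /csum; congr (_ +i* _).
- by rewrite (@rsum_reindex h) // => j /aout ->.
- by rewrite (@rsum_reindex h) // => j /aout ->.
Qed.

End sums.

Lemma small_invS {R : realType} (e : R) : 0 < e ->
  exists N, forall m : nat, (N <= m)%N -> m.+1%:R^-1 <= e.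
Proof.
move=> e0; exists (Num.truncn e^-1) => m lem.
rewrite -[leRHS]invrK lef_pV2 ?posrE ?invr_gt0//.
by apply: ltW; apply: lt_le_trans (truncnS_gt _) _; rewrite ler_nat.
Qed.

Section dot_basics.
Set Implicit Arguments.
Unset Strict Implicit.
Local Open Scope complex_scope.
Context {R : realType} {I : choiceType}.
Local Notation basis := Defs.basis.
Local Notation C := R[i].
Local Notation H := (l2 R I).
Implicit Types (u v w x y : H).

Lemma rsum_set1 (a : I -> R) i : (forall j, j <> i -> a j = 0) ->
  rsum a = a i.
Proof.
move=> a0; rewrite /rsum.
have -> : (\esum_(j in setT) ((EFin \o a)^\+)%E j = (maxe (a i)%:E 0))%E.
  rewrite (esumID [set i]); last by move=> j _; exact: funepos_ge0.
  rewrite setTI esum_set1 ?funepos_ge0// funeposE.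
  rewrite esum1 ?adde0// => j [_ /= /a0 aj].
  by rewrite funeposE/= aj maxxx.
have -> : (\esum_(j in setT) ((EFin \o a)^\-)%E j = (maxe (- (a i)%:E) 0))%E.
  rewrite (esumID [set i]); last by move=> j _; exact: funeneg_ge0.
  rewrite setTI esum_set1 ?funeneg_ge0// funenegE.
  rewrite esum1 ?adde0// => j [_ /= /a0 aj].
  by rewrite funenegE/= aj oppr0 maxxx.
rewrite -EFinN -!EFin_max -EFinB/=.
by rewrite maxEle maxEle; case: (leP (a i) 0); case: (leP (- a i) 0); lra.
Qed.

Lemma dot_basis u i : dot u (basis i) = u i.
Proof.
rewrite /dot /csum !(@rsum_set1 _ i).
- by rewrite /basis/= eqxx rmorph1 mulr1; case: (u i).
- by move=> j /eqP/negbTE ji; rewrite /basis/= ji rmorph0 mulr0.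
- by move=> j /eqP/negbTE ji; rewrite /basis/= ji rmorph0 mulr0.
Qed.

Lemma dotDl u v w : dot (u + v) w = dot u w + dot v w.
Proof. exact: linearDl. Qed.
Lemma dotDr u v w : dot u (v + w) = dot u v + dot u w.
Proof. exact: linearDr. Qed.
Lemma dotBl u v w : dot (u - v) w = dot u w - dot v w.
Proof. exact: linearBl. Qed.
Lemma dotBr u v w : dot u (v - w) = dot u v - dot u w.
Proof. exact: linearBr. Qed.
Lemma dotZl z u w : dot (z *: u) w = z * dot u w.
Proof. exact: linearZl_LR. Qed.
Lemma dotZr z u w : dot u (z *: w) = z^* * dot u w.
Proof. exact: linearZr_LR. Qed.
Lemma dot0l u : dot 0 u = 0 :> C.
Proof. exact: linear0l. Qed.
Lemma dot0r u : dot u 0 = 0 :> C.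
Proof. exact: linear0r. Qed.
Lemma dot_suml (T : Type) (r : seq T) (P : pred T) (F : T -> H) u :
  dot (\sum_(i <- r | P i) F i) u = \sum_(i <- r | P i) dot (F i) u.
Proof. exact: linear_sumlz. Qed.
Lemma dot_sumr (T : Type) (r : seq T) (P : pred T) (F : T -> H) u :
  dot u (\sum_(i <- r | P i) F i) = \sum_(i <- r | P i) dot u (F i).
Proof. exact: linear_sumr. Qed.

Lemma l2_eq u v : (forall w, dot u w = dot v w) -> u = v.
Proof. by move=> uv; apply: l2P => i; rewrite -!dot_basis uv. Qed.

Lemma dot_swap u v : dot u v = 0 -> dot v u = 0.
Proof. by rewrite dotC => /eqP; rewrite conjc_eq0 => /eqP. Qed.

(** The norm of l2 takes values in the complex numbers; estimates are carried
    out with this real squared norm instead. *)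
Definition nsq u : R := complex.Re (dot u u).

Lemma dotxx u : dot u u = (nsq u)%:C.
Proof.
have : 0 <= dot u u := dnorm_ge0 (@dot R I) u.
rewrite /nsq; case: (dot u u) => a b.
by rewrite lecE /= => /andP[/eqP -> _].
Qed.

Lemma nsq_ge0 u : 0 <= nsq u.
Proof. by rewrite -(@lecR R) -dotxx; exact: (dnorm_ge0 (@dot R I)). Qed.

Lemma nsq_eq0 u : nsq u = 0 -> u = 0.
Proof.
move=> u0; apply/eqP; rewrite -(dnorm_eq0 (@dot R I)).
by rewrite -[X in X == 0]/(dot u u) dotxx u0.
Qed.

Lemma normH_sqr u : `|u| ^+ 2 = (nsq u)%:C.
Proof. by rewrite -dotxx; exact: sqrtCK. Qed.

Lemma normH_eq u v : (`|u| = `|v|) <-> (nsq u = nsq v).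
Proof.
split=> [uv|uv].
  by apply: complexI; rewrite -!normH_sqr uv.
by apply/eqP; rewrite -(@eqrXn2 _ 2)// !normH_sqr uv.
Qed.

Lemma normH_le u (e : R) : 0 <= e -> (`|u| <= e%:C) = (nsq u <= e ^+ 2).
Proof.
move=> e0; rewrite -(@ler_pXn2r _ 2)// ?nnegrE ?lecR//.
by rewrite normH_sqr -rmorphXn lecR.
Qed.

Lemma nsq_psum u : nsq u = psum (fun i => normc (u i) ^+ 2).
Proof.
rewrite /nsq /dot /csum /=.
have -> : (fun i => complex.Re (u i * (u i)^*)) = (fun i => normc (u i) ^+ 2).
  apply/funext => i; rewrite normcE2; case: (u i) => a b /=.
  by rewrite mulrN opprK.
by rewrite rsum_ge0E => [//|i|]; [exact: sqr_ge0|exact: l2_summable].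
Qed.

Lemma sumsq_le_nsq u (A : set I) : finite_set A ->
  \sum_(i \in A) normc (u i) ^+ 2 <= nsq u.
Proof.
move=> fA; rewrite nsq_psum -lee_fin psumK; last exact: l2_summable.
  by apply: esum_ge; exists A => //; rewrite fsumEFin.
by move=> i; exact: sqr_ge0.
Qed.

Lemma coord_le_nsq u i : normc (u i) ^+ 2 <= nsq u.
Proof. by have := @sumsq_le_nsq u _ (finite_set1 i); rewrite fsbig_set1. Qed.

(** Finite partial sums decide membership in l2; this is how limits taken
    coordinate by coordinate are shown to be vectors. *)
Lemma l2_bounded_sums (f : I -> C) (e : R) :
  (forall A, finite_set A -> \sum_(i \in A) normc (f i) ^+ 2 <= e) ->
  exists2 u : H, u =1 f & nsq u <= e.
Proof.
move=> fe.
have le_e : (\esum_(i in setT) (normc (f i) ^+ 2)%:E <= e%:E)%E.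
  apply: ub_ereal_sup => _ [A [fA _] <-].
  by rewrite fsumEFin // lee_fin; exact: fe.
have sf : f \in @square_summable R I.
  apply/square_summableP; rewrite /rsummable /summable /=.
  under eq_esum do rewrite ger0_norm ?sqr_ge0//.
  by apply: le_lt_trans le_e _; rewrite ltry.
exists (L2 sf) => //; rewrite nsq_psum -lee_fin psumK //.
- by move=> i; exact: sqr_ge0.
- exact: (l2_summable (L2 sf)).
Qed.

Lemma nsqD u v : nsq (u + v) = nsq u + nsq v + 2 * complex.Re (dot u v).
Proof.
rewrite /nsq dotDl !dotDr [dot v u]dotC.
by case: (dot u u) (dot u v) (dot v v) => a b [c d] [e f] /=; lra.
Qed.

Lemma nsqZ (z : C) u : nsq (z *: u) = normc z ^+ 2 * nsq u.
Proof.
rewrite {1}/nsq dotZl dotZr dotxx mulrA; case: z => a b.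
by rewrite normcE2 /=; lra.
Qed.

Lemma nsqN u : nsq (- u) = nsq u.
Proof. by rewrite -scaleN1r nsqZ normcN normc1 expr1n mul1r. Qed.

Lemma nsqB u v : nsq (u - v) = nsq u + nsq v - 2 * complex.Re (dot u v).
Proof.
rewrite nsqD nsqN -scaleN1r dotZr.
by case: (dot u v) => a b /=; lra.
Qed.

Lemma parallelogram u v : nsq (u + v) + nsq (u - v) = 2 * nsq u + 2 * nsq v.
Proof. by rewrite nsqD nsqB; lra. Qed.

Lemma nsqD_le u v : nsq (u + v) <= 2 * nsq u + 2 * nsq v.
Proof. by rewrite -parallelogram lerDl nsq_ge0. Qed.

(** Turns the complex-valued epsilons of the norm topology into real ones. *)
Lemma cvgHP (x : nat -> H) l : x @ \oo --> l <->
  forall e : R, 0 < e -> \forall m \near \oo, nsq (l - x m) <= e.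
Proof.
split=> [/cvgrPdist_le xl e e0|xl].
  have s0 : 0 < Num.sqrt e by rewrite sqrtr_gt0.
  have sC : 0 < (Num.sqrt e)%:C by rewrite ltcR.
  apply: filterS (xl _ sC) => m.
  by rewrite normH_le ?(ltW s0)// sqr_sqrtr// ltW.
apply/cvgrPdist_le => e e0.
have [r r0 ->] : exists2 r : R, 0 < r & e = r%:C.
  case: e e0 => a b; rewrite ltcE /= => /andP[/eqP -> a0].
  by exists a.
apply: filterS (xl _ (exprn_gt0 2 r0)) => m.
by rewrite normH_le// ltW.
Qed.

Lemma closedHP (K : set H) : closed K <->
  forall x, (forall e : R, 0 < e -> exists2 y, K y & nsq (x - y) <= e) -> K x.
Proof.
split=> [Kcl x xK|xK].
  have inv0 m : 0 < (m.+1%:R : R)^-1 by rewrite invr_gt0.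
  have /choice[y yP] : forall m : nat, exists y,
      K y /\ nsq (x - y) <= (m.+1%:R : R)^-1.
    by move=> m; have [y Ky xy] := xK _ (inv0 m); exists y.
  apply: (@closed_cvg _ _ \oo _ y K Kcl).
    by apply: nearW => m; have [] := yP m.
  apply/cvgHP => e e0; near=> m.
  have [_ /le_trans->//] := yP m.
  by near: m; have [N NP] := small_invS e0; exists N.
move=> x xcl; apply: xK => e e0.
have s0 : 0 < (Num.sqrt e)%:C by rewrite ltcR sqrtr_gt0.
have [y [Ky]] := xcl _ (nbhsx_ballx x (Num.sqrt e)%:C s0).
rewrite -ball_normE /= => /ltW; rewrite normH_le ?sqrtr_ge0// sqr_sqrtr ?(ltW e0)// => xy.
by exists y.
Unshelve. all: by end_near.
Qed.

End dot_basics.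

(** * Completeness and orthogonal projections *)

Section completeness.
Set Implicit Arguments.
Unset Strict Implicit.
Local Open Scope complex_scope.
Context {R : realType} {I : choiceType}.
Local Notation C := R[i].
Local Notation H := (l2 R I).
Local Notation basis := Defs.basis.
Local Notation proj := Defs.proj.
Implicit Types (u v x y : H).

Lemma real_cauchy_cvg (a : nat -> R) :
  (forall e : R, 0 < e -> exists N, forall m, (N <= m)%N -> (a N - a m) ^+ 2 <= e) ->
  cvg (a @ \oo).
Proof.
move=> ca; apply/cauchy_cvgP/cauchy_exP => e e0.
have e2 : 0 < e / 2 by rewrite divr_gt0.
have [N aN] := ca _ (exprn_gt0 2 e2); exists (a N); exists N => // m /= /aN.
rewrite -ball_normE /= -(@real_normK _ (a N - a m)) ?num_real// => am.
suff : `|a N - a m| <= e / 2 by lra.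
by rewrite -(@ler_pXn2r _ 2)// ?nnegrE ?normr_ge0// ltW.
Qed.

Lemma cvg_sum_seq (T : Type) (r : seq T) (F : T -> nat -> R) (a : T -> R) :
  (forall t, F t @ \oo --> a t) ->
  (fun m => \sum_(t <- r) F t m) @ \oo --> \sum_(t <- r) a t.
Proof.
move=> Fa; elim: r => [|t r IH].
  under eq_fun do rewrite big_nil; rewrite big_nil; exact: cvg_cst.
by under eq_fun do rewrite big_cons; rewrite big_cons; exact: cvgD.
Qed.

(** The limit is taken coordinatewise; each finite partial sum of the squared
    distance to it is a limit of partial sums bounded by the Cauchy condition. *)
Theorem l2_complete (x : nat -> H) :
  (forall e : R, 0 < e -> exists N, forall a b, (N <= a)%N -> (N <= b)%N ->
     nsq (x a - x b) <= e) ->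
  exists l : H, x @ \oo --> l.
Proof.
move=> cx.
have coordB i a b : (x a - x b) i = x a i - x b i by [].
have cRe i : cvg ((fun a => complex.Re (x a i)) @ \oo).
  apply: real_cauchy_cvg => e /cx[N xN]; exists N => m Nm.
  apply: le_trans (xN N m (leqnn N) Nm); apply: le_trans (coord_le_nsq _ i).
  rewrite normcE2 coordB; case: (x N i) (x m i) => [a b] [c d] /=.
  by rewrite lerDl sqr_ge0.
have cIm i : cvg ((fun a => complex.Im (x a i)) @ \oo).
  apply: real_cauchy_cvg => e /cx[N xN]; exists N => m Nm.
  apply: le_trans (xN N m (leqnn N) Nm); apply: le_trans (coord_le_nsq _ i).
  rewrite normcE2 coordB; case: (x N i) (x m i) => [a b] [c d] /=.
  by rewrite lerDr sqr_ge0.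
pose f i := lim ((fun a => complex.Re (x a i)) @ \oo) +i*
            lim ((fun a => complex.Im (x a i)) @ \oo).
have cSq (a : nat -> R) c : cvg (a @ \oo) ->
    (fun b => (a b - c) ^+ 2) @ \oo --> (lim (a @ \oo) - c) ^+ 2.
  move=> ca; have h : (fun b => a b - c) @ \oo --> lim (a @ \oo) - c.
    by apply: cvgB => //; exact: cvg_cst.
  exact: (cvgM h h).
have fbound (e : R) N a : (forall b, (N <= b)%N -> nsq (x b - x a) <= e) ->
    forall A, finite_set A -> \sum_(i \in A) normc (f i - x a i) ^+ 2 <= e.
  move=> xe A fA.
  pose g i b := normc (x b i - x a i) ^+ 2.
  have gcvg i : g i @ \oo --> normc (f i - x a i) ^+ 2.
    have -> : g i = (fun b => (complex.Re (x b i) - complex.Re (x a i)) ^+ 2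
                   + (complex.Im (x b i) - complex.Im (x a i)) ^+ 2).
      by apply/funext => b; rewrite /g normcE2; case: (x b i) (x a i) => ? ? [].
    rewrite normcE2 (_ : complex.Re (f i - x a i) =
      lim ((fun a => complex.Re (x a i)) @ \oo) - complex.Re (x a i)); last first.
      by rewrite /f; case: (x a i).
    rewrite (_ : complex.Im (f i - x a i) =
      lim ((fun a => complex.Im (x a i)) @ \oo) - complex.Im (x a i)); last first.
      by rewrite /f; case: (x a i).
    exact: cvgD (cSq _ _ (cRe i)) (cSq _ _ (cIm i)).
  rewrite fsbig_finite//; apply: (cvgr_to_le (@cvg_sum_seq _ _ g _ gcvg)).
  exists N => // b /= /xe; apply: le_trans.
  rewrite -fsbig_finite//.
  by have := sumsq_le_nsq (x b - x a) fA.
have [N xN] := cx _ (@ltr01 R).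
have [l0 l0E _] := l2_bounded_sums (fbound 1 N N (fun b Nb => xN b N Nb (leqnn N))).
have lE i : (l0 + x N) i = f i.
  by rewrite -[LHS]/(l0 i + x N i) l0E subrK.
exists (l0 + x N); apply/cvgHP => e /cx[N' xN']; exists N' => // a /= N'a.
have [u uE ue] := l2_bounded_sums (fbound e N' a (fun b Nb => xN' b a Nb N'a)).
suff -> : l0 + x N - x a = u by [].
by apply: l2P => i; rewrite uE -[LHS]/((l0 + x N) i - x a i) lE.
Qed.

End completeness.

Section projection_theorem.
Set Implicit Arguments.
Unset Strict Implicit.
Local Open Scope complex_scope.
Context {R : realType} {I : choiceType}.
Local Notation C := R[i].
Local Notation H := (l2 R I).
Local Notation basis := Defs.basis.
Local Notation proj := Defs.proj.
Implicit Types (u v x y : H) (M : set H).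

Section closed_subspace_theory.
Context (M : set H) (clM : closed_subspace M).

Lemma subspace0 : M 0. Proof. by case: clM. Qed.
Lemma subspaceZ (z : C) x : M x -> M (z *: x).
Proof.
by case: clM => M0 MP _ Mx; rewrite -[_ *: _]addr0; apply: MP.
Qed.
Lemma subspaceD x y : M x -> M y -> M (x + y).
Proof. by case: clM => _ MP _ Mx My; rewrite -[x]scale1r; apply: MP. Qed.
Lemma subspaceN x : M x -> M (- x).
Proof. by rewrite -scaleN1r; apply: subspaceZ. Qed.
Lemma subspaceB x y : M x -> M y -> M (x - y).
Proof. by move=> Mx /subspaceN; apply: subspaceD. Qed.
Lemma subspace_sum (T : Type) (r : seq T) (P : pred T) (F : T -> H) :
  (forall t, P t -> M (F t)) -> M (\sum_(t <- r | P t) F t).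
Proof.
by move=> MF; elim/big_ind: _ => //; [exact: subspace0|exact: subspaceD].
Qed.
Lemma subspace_lim (x : nat -> H) l :
  (forall m, M (x m)) -> x @ \oo --> l -> M l.
Proof.
case: clM => _ _ Mcl Mx xl; apply: (@closed_cvg _ _ \oo _ x M Mcl) xl.
exact: nearW.
Qed.

End closed_subspace_theory.

(** A quantitative form of the continuity of the norm: expand |d u - v|^2 >= 0
    and divide by d. *)
Lemma nsqD_young (d : R) u v : 0 < d ->
  nsq (u + v) <= (1 + d) * nsq u + (1 + d^-1) * nsq v.
Proof.
move=> d0; have := nsq_ge0 (d%:C *: u - v).
rewrite nsqB nsqZ dotZl nsqD normcE2; case: (dot u v) => a b /=.
move: (nsq u) (nsq v) => p q h; rewrite -subr_ge0.
have -> : (1 + d) * p + (1 + d^-1) * q - (p + q + 2 * a)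
   = d^-1 * ((d ^+ 2 + 0 ^+ 2) * p + q - 2 * (d * a - 0 * b)).
  by field; rewrite gt_eqF.
by rewrite mulr_ge0// invr_ge0 ltW.
Qed.

(** By the parallelogram identity a minimizing sequence for the distance is
    Cauchy, because midpoints stay in the subspace. *)
Theorem nearest_point M x : closed_subspace M ->
  exists2 p, M p & forall m, M m -> nsq (x - p) <= nsq (x - m).
Proof.
move=> clM; pose D := [set nsq (x - m) | m in M].
have D0 : D (nsq (x - 0)) by exists 0 => //; exact: subspace0.
have infD : has_inf D.
  by split; [exists (nsq (x - 0))|exists 0 => _ [m _ <-]; exact: nsq_ge0].
pose d := inf D.
have d_le m : M m -> d <= nsq (x - m).
  by move=> Mm; apply: ge_inf; [exact: infD.2|exists m].
have d0 : 0 <= d.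
  by apply: lb_le_inf => [|_ [m _ <-]]; [exact: infD.1|exact: nsq_ge0].
have near_min (l : nat) : exists m, M m /\ nsq (x - m) < d + l.+1%:R^-1.
  have l0 : 0 < (l.+1%:R : R)^-1 by rewrite invr_gt0.
  by have [_ [m Mm <-] xm] := inf_adherent l0 infD; exists m.
have [m mP] := choice near_min.
have half_sum a b : nsq (m a - m b) <=
    2 * (nsq (x - m a) - d) + 2 * (nsq (x - m b) - d).
  have := parallelogram (x - m a) (x - m b).
  have -> : x - m a - (x - m b) = - (m a - m b) by rewrite !opprB addrC addrA subrK.
  have -> : x - m a + (x - m b) = 2%:C *: (x - 2^-1%:C *: (m a + m b)).
    rewrite scalerBr scalerA -rmorphM mulfV ?pnatr_eq0// scale1r opprD.
    by rewrite rmorphMn rmorph1 scaler_nat mulr2n addrACA.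
  have := d_le _ (subspaceZ clM 2^-1%:C (subspaceD clM (mP a).1 (mP b).1)).
  have four : normc (2%:C : C) ^+ 2 = 4 by rewrite normcE2 /=; lra.
  by rewrite nsqN nsqZ four; lra.
have [e e0|p mp] := l2_complete (x := m).
  have e4 : 0 < e / 4 by rewrite divr_gt0.
  have [N NP] := small_invS e4; exists N => a b Na Nb.
  apply: le_trans (half_sum a b) _.
  have mle c : (N <= c)%N -> nsq (x - m c) <= d + e / 4.
    by move=> Nc; apply: le_trans (ltW (mP c).2) _; rewrite lerD2l NP.
  by have := mle a Na; have := mle b Nb; lra.
exists p => [|y /d_le]; first by apply: subspace_lim mp => // a; exact: (mP a).1.
apply: le_trans; apply/ler_addgt0Pr => e e0.
(* This t makes (1 + t)(d + t) + t^2 + t at most d + t(d + 4) <= d + e. *)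
pose t := Num.min 1 (e / (d + 4)).
have d4 : 0 < d + 4 by lra.
have t0 : 0 < t by rewrite lt_min ltr01 divr_gt0.
have t1 : t <= 1 by rewrite ge_min lexx.
have te : t * (d + 4) <= e by rewrite -ler_pdivlMr// ge_min lexx orbT.
have [N NP] := small_invS t0; have [N' _ N'P] := (cvgHP m p).1 mp _ (exprn_gt0 2 t0).
pose l := maxn N N'.
have xl : nsq (x - m l) <= d + t.
  by apply: le_trans (ltW (mP l).2) _; rewrite lerD2l NP// leq_maxl.
have lp : nsq (m l - p) <= t ^+ 2.
  by rewrite -nsqN opprB; apply: N'P; rewrite /= leq_maxr.
have -> : x - p = (x - m l) + (m l - p) by rewrite addrA subrK.
apply: le_trans (nsqD_young _ _ t0) _.
have : (1 + t) * nsq (x - m l) <= (1 + t) * (d + t).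
  by rewrite ler_pM2l//; lra.
have : (1 + t^-1) * nsq (m l - p) <= (1 + t^-1) * t ^+ 2.
  by rewrite ler_pM2l// addr_gt0// invr_gt0.
have -> : (1 + t^-1) * t ^+ 2 = t ^+ 2 + t by field; rewrite gt_eqF.
by nra.
Qed.

(** Otherwise moving p by a small multiple of <x - p, m> m would bring it
    closer to x. *)
Lemma nearest_point_orth M x p : closed_subspace M -> M p ->
  (forall m, M m -> nsq (x - p) <= nsq (x - m)) ->
  forall m, M m -> dot (x - p) m = 0.
Proof.
move=> clM Mp pmin m Mm; set b := dot (x - p) m.
(* Small enough that the quadratic term t^2 |b|^2 |m|^2 stays below t |b|^2. *)
pose t : R := (nsq m + 1)^-1.
have m1 : 0 < nsq m + 1 by have := nsq_ge0 m; lra.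
have t0 : 0 < t by rewrite invr_gt0.
have := pmin _ (subspaceD clM Mp (subspaceZ clM (t%:C * b) Mm)).
rewrite opprD addrA [leRHS]nsqB nsqZ dotZr -/b => h.
have tm : t * nsq m <= 1.
  by rewrite /t mulrC ler_pdivrMr//; lra.
have b0 : normc b ^+ 2 <= 0.
  have : 2 * (t * normc b ^+ 2) <= t * (t * nsq m) * normc b ^+ 2.
    move: h; rewrite -addrA lerDl subr_ge0 normcM exprMn !normcE2.
    by clearbody b; case: b => c f /=; lra.
  have tb : 0 <= t * normc b ^+ 2 by rewrite mulr_ge0 ?sqr_ge0 ?ltW.
  have : t * (t * nsq m) * normc b ^+ 2 <= t * normc b ^+ 2.
    by rewrite mulrAC ler_piMr.
  by move=> h1 h2; rewrite -(pmulr_rle0 _ t0); lra.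
apply: eq0_normc; apply/eqP; rewrite -sqrf_eq0; apply/eqP/le_anti.
by rewrite b0 sqr_ge0.
Qed.

Lemma proj_unique M x p : M p -> (forall m, M m -> dot (x - p) m = 0) ->
  closed_subspace M -> proj M x = p.
Proof.
move=> Mp pM clM; apply: xget_unique => // q [Mq qM].
apply/eqP; rewrite -subr_eq0; apply/eqP/nsq_eq0.
have Mqp := subspaceB clM Mq Mp.
have : dot (q - p) (q - p) = 0.
  rewrite -{1}[q](subrK x) -addrA addrC -[q - x]opprB -[X in _ + X]opprK.
  by rewrite opprK dotDl pM// -scaleN1r dotZl qM// mulr0 addr0.
by rewrite dotxx => /eqP; rewrite eq_complex => /andP[/eqP].
Qed.

Lemma proj_mem M x : closed_subspace M -> M (proj M x).
Proof.
move=> clM; have [p Mp pmin] := nearest_point x clM.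
by rewrite (@proj_unique M x p)//; exact: nearest_point_orth.
Qed.

Lemma proj_orth M x m : closed_subspace M -> M m -> dot (x - proj M x) m = 0.
Proof.
move=> clM Mm; have [p Mp pmin] := nearest_point x clM.
have pM := nearest_point_orth clM Mp pmin.
by rewrite (@proj_unique M x p)// pM.
Qed.

Lemma proj_id M x : closed_subspace M -> M x -> proj M x = x.
Proof.
by move=> clM Mx; apply: proj_unique => // m _; rewrite subrr dot0l.
Qed.

(** Finitely supported vectors are dense: the residual of x after projecting
    onto K has no coordinates left. *)
Lemma basis_total K : closed_subspace K -> (forall i, K (basis i)) ->
  forall x, K x.
Proof.
move=> clK Kb x; suff -> : x = proj K x by exact: proj_mem.
apply/eqP; rewrite -subr_eq0; apply/eqP/l2P => i.
by rewrite -dot_basis proj_orth.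
Qed.

End projection_theorem.

(** * Operators with adjoints *)

Section operators.
Set Implicit Arguments.
Unset Strict Implicit.
Local Open Scope complex_scope.
Context {R : realType} {I : choiceType}.
Local Notation C := R[i].
Local Notation H := (l2 R I).
Local Notation basis := Defs.basis.
Local Notation proj := Defs.proj.
Implicit Types (T U : H -> H) (u v x y : H) (M : set H).

Section linear_maps.
Context (T : H -> H) (linT : linear T).

Lemma lin0 : T 0 = 0.
Proof.
have := linT 1 0 0; rewrite !scale1r addr0 => T00.
by apply: (addrI (T 0)); rewrite addr0 -T00.
Qed.
Lemma linD x y : T (x + y) = T x + T y.
Proof. by have := linT 1 x y; rewrite !scale1r. Qed.
Lemma linZ (z : C) x : T (z *: x) = z *: T x.
Proof. by have := linT z x 0; rewrite !addr0 lin0 addr0. Qed.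
Lemma linB x y : T (x - y) = T x - T y.
Proof. by rewrite linD -scaleN1r linZ scaleN1r. Qed.
Lemma lin_sum (A : Type) (r : seq A) (P : pred A) (F : A -> H) :
  T (\sum_(a <- r | P a) F a) = \sum_(a <- r | P a) T (F a).
Proof. exact: (big_morph T linD lin0). Qed.

End linear_maps.

(** Every operator below has an explicit adjoint, which replaces boundedness:
    linearity follows, and equality can be tested on basis vectors. *)
Definition adjoint_pair T T' := forall x y, dot (T x) y = dot x (T' y).

Lemma adjoint_sym T T' : adjoint_pair T T' -> adjoint_pair T' T.
Proof. by move=> TT' x y; rewrite dotC -TT' -dotC. Qed.

Lemma adjoint_linear T T' : adjoint_pair T T' -> linear T.
Proof.
by move=> TT' z x y; apply: l2_eq => w; rewrite dotDl dotZl !TT' dotDl dotZl.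
Qed.

Lemma adjE T T' : adjoint_pair T T' -> adj T = T'.
Proof.
move=> TT'; apply/funext => y; apply: xget_unique => [x|z zP]; first exact: TT'.
apply: l2_eq => w; rewrite dotC -zP TT' -dotC //.
Qed.

Lemma adjoint_id : adjoint_pair id id. Proof. by []. Qed.

Lemma adjoint_comp T T' U U' : adjoint_pair T T' -> adjoint_pair U U' ->
  adjoint_pair (T \o U) (U' \o T').
Proof. by move=> TT' UU' x y /=; rewrite TT' UU'. Qed.

Lemma adjoint_sub T T' U U' : adjoint_pair T T' -> adjoint_pair U U' ->
  adjoint_pair (T \- U) (T' \- U').
Proof. by move=> TT' UU' x y /=; rewrite dotBl dotBr TT' UU'. Qed.

Lemma adjoint_sum (A : Type) (r : seq A) (P : pred A) (F F' : A -> H -> H) :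
  (forall a, P a -> adjoint_pair (F a) (F' a)) ->
  adjoint_pair (fun x => \sum_(a <- r | P a) F a x)
               (fun x => \sum_(a <- r | P a) F' a x).
Proof.
move=> FF' x y; rewrite dot_suml dot_sumr.
by apply: eq_bigr => a Pa; exact: FF'.
Qed.

Lemma adjoint_scale (z : C) T T' : adjoint_pair T T' ->
  adjoint_pair (fun x => z *: T x) (fun x => z^* *: T' x).
Proof. by move=> TT' x y; rewrite dotZl dotZr TT' conjCK. Qed.

(** Coordinates of T x are pairings of x with the adjoint applied to basis
    vectors, and the coordinates of those are matrix entries of T; so no
    continuity argument is needed. *)
Lemma adjoint_ext T T' U U' : adjoint_pair T T' -> adjoint_pair U U' ->
  (forall i, T (basis i) = U (basis i)) -> T = U.
Proof.
move=> TT' UU' TU; apply/funext => x; apply: l2P => i.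
rewrite -!dot_basis TT' UU'; congr dot; apply: l2P => j.
by rewrite -!dot_basis dotC -TT' TU UU' -dotC.
Qed.

Definition orth_projection T := adjoint_pair T T /\ forall x, T (T x) = T x.

Lemma proj_orth_projection M : closed_subspace M -> orth_projection (proj M).
Proof.
move=> clM; split=> [x y|x]; last by apply: proj_id => //; exact: proj_mem.
transitivity (dot (proj M x) (proj M y)).
  apply/eqP; rewrite -subr_eq0 -dotBr; apply/eqP/dot_swap.
  by apply: proj_orth => //; exact: proj_mem.
apply/eqP; rewrite eq_sym -subr_eq0 -dotBl; apply/eqP.
by apply: proj_orth => //; exact: proj_mem.
Qed.

Lemma orth_projection_dot T x : orth_projection T ->
  dot (T x) x = (nsq (T x))%:C.
Proof. by case=> TT Tid; rewrite -dotxx -TT Tid. Qed.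

Lemma orth_projection_contr T x : orth_projection T -> nsq (T x) <= nsq x.
Proof.
move=> pT; have := nsq_ge0 (x - T x); rewrite nsqB.
rewrite dotC (orth_projection_dot _ pT) /=; lra.
Qed.

Lemma nsq_shift (h : I -> I) (hI : injective h) u :
  nsq (Defs.shift hI u) = nsq u.
Proof.
rewrite !nsq_psum /psum; congr fine.
rewrite (esum_reindex hI) => [|j|j hj].
- by apply: eq_esum => i _ /=; rewrite pushforwardE.
- by rewrite lee_fin sqr_ge0.
- by rewrite /= pushforward_out// normc0 expr0n.
Qed.

Fact coshift_subproof (h : I -> I) (hI : injective h) u :
  u \o h \in @square_summable R I.
Proof.
apply/square_summableP; have := l2_summable u.
rewrite /rsummable /summable; apply: le_lt_trans.
rewrite [leRHS](esumID (range h))// setTI esum_image; last by move=> ? ? _ _ /hI.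
by rewrite leeDl//; apply: esum_ge0.
Qed.

Definition coshift (h : I -> I) (hI : injective h) u : H :=
  L2 (coshift_subproof hI u).

Lemma adjoint_shift (h : I -> I) (hI : injective h) :
  adjoint_pair (Defs.shift hI) (coshift hI).
Proof.
move=> u v; rewrite /dot (csum_reindex hI) => [|j hj]; last first.
  by rewrite /= pushforward_out// mul0r.
by congr csum; apply/funext => i /=; rewrite pushforwardE.
Qed.

Lemma coshiftK (h : I -> I) (hI : injective h) :
  cancel (Defs.shift hI) (coshift hI).
Proof. by move=> u; apply: l2P => i /=; rewrite pushforwardE. Qed.

Lemma shift_comp (g h gh : I -> I) (gI : injective g) (hI : injective h)
    (ghI : injective gh) : gh =1 g \o h ->
  Defs.shift gI \o Defs.shift hI = Defs.shift ghI :> (H -> H).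
Proof.
move=> ghE; apply: (adjoint_ext (T' := coshift hI \o coshift gI)
  (U' := coshift ghI)).
- exact: adjoint_comp (adjoint_shift _) (adjoint_shift _).
- exact: adjoint_shift.
- by move=> i /=; rewrite !shift_basis ghE.
Qed.

Lemma cvg_bounded T (c : R) (x : nat -> H) l : linear T -> 0 < c ->
  (forall y, nsq (T y) <= c * nsq y) ->
  x @ \oo --> l -> (fun m => T (x m)) @ \oo --> T l.
Proof.
move=> linT c0 Tc /cvgHP xl; apply/cvgHP => e e0.
have ec : 0 < e / c by rewrite divr_gt0.
apply: filterS (xl _ ec) => m; rewrite ler_pdivlMr// => h.
by rewrite -linB//; apply: le_trans (Tc _) _; rewrite mulrC.
Qed.

(** For a uniformly bounded sequence the vectors on which it tends to 0 form
    a closed subspace, so that basis vectors suffice. *)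
Lemma strong_cvg0 (A : nat -> H -> H) (c : R) : 0 < c ->
  (forall m, linear (A m)) ->
  (forall m y, nsq (A m y) <= c * nsq y) ->
  (forall i, (fun m => A m (basis i)) @ \oo --> (0 : H)) ->
  forall x, (fun m => A m x) @ \oo --> (0 : H).
Proof.
move=> c0 linA Ac Ab.
pose K := [set x : H | (fun m => A m x) @ \oo --> (0 : H)].
suff clK : closed_subspace K by exact: (basis_total clK).
split.
- by rewrite /K /=; under eq_fun do rewrite lin0//; exact: cvg_cst.
- move=> z x y Kx Ky; rewrite /K /=; under eq_fun do rewrite linA.
  by rewrite -[0]addr0 -[X in X + _](scaler0 _ z); apply: cvgD => //;
    exact: cvgZl_tmp.
- apply/closedHP => x xK; apply/cvgHP => e e0.
  have e4 : 0 < e / (4 * c) by rewrite divr_gt0// mulr_gt0.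
  have [y Ky xy] := xK _ e4.
  have e4' : 0 < e / 4 by rewrite divr_gt0.
  move: Ky => /cvgHP/(_ _ e4'); apply: filterS => m.
  rewrite !sub0r !nsqN => Ay.
  have : nsq (A m (x - y)) <= e / 4.
    apply: le_trans (Ac _ _) _.
    have -> : e / 4 = c * (e / (4 * c)) by field; rewrite gt_eqF.
    by rewrite ler_pM2l.
  have := nsqD_le (A m (x - y)) (A m y).
  by rewrite -linD// subrK; lra.
Qed.

End operators.

(** * Words, creation operators and iterated defects *)

Section words.
Set Implicit Arguments.
Unset Strict Implicit.
Context {k : nat} {n : 'I_k -> nat}.
Local Notation W := (word n).

Definition empty_word : W := finfun (fun i => [::]).

Lemma word_set_at (w : W) i (a : seq 'I_(n i)) : word_set w a i = a.
Proof. by rewrite ffunE dfwithin. Qed.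

Lemma word_set_out (w : W) i (a : seq 'I_(n i)) i' : i != i' ->
  word_set w a i' = w i'.
Proof. by move=> ii'; rewrite ffunE dfwithout. Qed.

Lemma wordP (v w : W) : (forall i, v i = w i) -> v = w.
Proof. by move=> vw; apply/ffunP. Qed.

Lemma lcons_word_set (w : W) i (j : 'I_(n i)) a : w i = j :: a ->
  lcons j (word_set w a) = w.
Proof.
move=> wi; apply: wordP => i'; rewrite /lcons.
have [<-|ii'] := eqVneq i i'; first by rewrite !word_set_at.
by rewrite !word_set_out.
Qed.

Lemma word_set_lcons (w : W) i (j : 'I_(n i)) :
  word_set (lcons j w) (w i) = w.
Proof.
apply: wordP => i'.
have [<-|ii'] := eqVneq i i'; first by rewrite word_set_at.
by rewrite !word_set_out.
Qed.

Lemma lcons_at (w : W) i (j : 'I_(n i)) : lcons j w i = j :: w i.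
Proof. exact: word_set_at. Qed.

(** Every word is reached from the empty one by left multiplications with
    letters, in whatever order of the factors. *)
Lemma word_ind (P : W -> Prop) : P empty_word ->
  (forall i (j : 'I_(n i)) w, P w -> P (lcons j w)) -> forall w, P w.
Proof.
move=> P0 PS w; have [m] := ubnP (\sum_i size (w i)).
elim: m w => // m IH w wm.
have [w0|] := pselect (forall i, w i = [::]).
  by have -> : w = empty_word by apply: wordP => i; rewrite w0 ffunE.
move=> /existsNP[i ]; case wi: (w i) => [//|j a] _.
rewrite -(lcons_word_set wi); apply/PS/IH; move: wm.
rewrite (bigD1 i)//= wi => wm; rewrite (bigD1 i)//= word_set_at.
move: wm; rewrite addSn ltnS; apply: leq_ltn_trans.
by rewrite leq_add2l leq_sum// => i' ii'; rewrite word_set_out// eq_sym.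
Qed.

End words.

Section fock_defect.
Set Implicit Arguments.
Unset Strict Implicit.
Local Open Scope complex_scope.
Context {R : realType} {k : nat} {n : 'I_k -> nat}.
Local Notation C := R[i].
Local Notation F := (fock R n).
Local Notation W := (word n).
Local Notation basis := (@Defs.basis R W).
Local Notation proj := Defs.proj.
Implicit Types (x y f : F) (Y Z T : F -> F) (w u v : W).

Definition lannihilate i (j : 'I_(n i)) : F -> F :=
  coshift (@lcons_inj k n i j).

Lemma lcreate_adjoint i (j : 'I_(n i)) :
  adjoint_pair (lcreate (R := R) j) (lannihilate j).
Proof. exact: adjoint_shift. Qed.

Lemma lcreate_linear i (j : 'I_(n i)) : linear (lcreate (R := R) j).
Proof. exact: adjoint_linear (lcreate_adjoint j). Qed.

Lemma lannihilate_linear i (j : 'I_(n i)) : linear (lannihilate j).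
Proof. exact: adjoint_linear (adjoint_sym (lcreate_adjoint j)). Qed.

Lemma lannihilateK i (j : 'I_(n i)) : cancel (lcreate (R := R) j) (lannihilate j).
Proof. exact: coshiftK. Qed.

Lemma nsq_lcreate i (j : 'I_(n i)) f : nsq (lcreate j f) = nsq f.
Proof. exact: nsq_shift. Qed.

Lemma lannihilate_lcons i (j : 'I_(n i)) w :
  lannihilate j (basis (lcons j w)) = basis w.
Proof. by rewrite -[basis (lcons j w)](shift_basis (@lcons_inj k n i j)) lannihilateK. Qed.

Lemma lannihilate_basis_out i (j : 'I_(n i)) u :
  (forall a, u i <> j :: a) -> lannihilate j (basis u) = 0.
Proof.
move=> uj; apply: l2P => w; rewrite -[LHS]/((lcons j w == u)%:R).
by case: eqP => // wu; case: (uj (w i)); rewrite -wu lcons_at.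
Qed.

Lemma lcreate_out i (j : 'I_(n i)) f w :
  (forall a, w i <> j :: a) -> lcreate j f w = 0.
Proof. by move=> wj; rewrite -dot_basis lcreate_adjoint lannihilate_basis_out// dot0r. Qed.

Lemma lcreate_at i (j : 'I_(n i)) f w a : w i = j :: a ->
  lcreate j f w = f (word_set w a).
Proof.
move=> wj; rewrite -dot_basis lcreate_adjoint.
by rewrite -{1}(lcons_word_set wj) lannihilate_lcons dot_basis.
Qed.

Lemma PhiE i Y f :
  Phi i Y f = \sum_(j < n i) lcreate j (Y (lannihilate j f)).
Proof. by apply: eq_bigr => j _; rewrite (adjE (lcreate_adjoint j)). Qed.

Lemma Phi_dot i Y x y : dot (Phi i Y x) y =
  \sum_(j < n i) dot (Y (lannihilate j x)) (lannihilate j y).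
Proof. by rewrite PhiE dot_suml; apply: eq_bigr => j _; exact: lcreate_adjoint. Qed.

Lemma Phi_nil i Y f w : w i = [::] -> Phi i Y f w = 0.
Proof.
move=> wi; rewrite -dot_basis Phi_dot big1// => j _.
by rewrite lannihilate_basis_out ?dot0r// wi.
Qed.

Lemma Phi_cons i Y f w (j : 'I_(n i)) a : w i = j :: a ->
  Phi i Y f w = Y (lannihilate j f) (word_set w a).
Proof.
move=> wi; rewrite -dot_basis Phi_dot (bigD1 j)//= big1 ?addr0 => [|j' jj'].
  by rewrite -{1}(lcons_word_set wi) lannihilate_lcons dot_basis.
rewrite lannihilate_basis_out ?dot0r// => b; rewrite wi => -[jj _].
by rewrite jj eqxx in jj'.
Qed.

Lemma Phi_adjoint i Y Y' : adjoint_pair Y Y' -> adjoint_pair (Phi i Y) (Phi i Y').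
Proof.
move=> YY' x y; rewrite Phi_dot [RHS]dotC Phi_dot rmorph_sum.
by apply: eq_bigr => j _; rewrite YY' dotC.
Qed.

Lemma Phi_linear i Y : linear Y -> linear (Phi i Y).
Proof.
move=> lY z x y; rewrite !PhiE scaler_sumr -big_split; apply: eq_bigr => j _ /=.
by rewrite lannihilate_linear lY lcreate_linear.
Qed.

(** The defect is studied through all suffixes of the list of factors: each
    claim about it is proved by adding one factor at a time. *)
Definition partial_defect (r : seq 'I_k) Y : F -> F :=
  foldr (fun i Y => Y \- Phi i Y) Y r.

Lemma defectE (M : set F) : defect M = partial_defect (index_enum 'I_k) (proj M).
Proof.
rewrite /defect /partial_defect; elim: (index_enum _) => [|i r IH] /=.
  by rewrite big_nil.
by rewrite big_cons /= IH.
Qed.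

Lemma partial_defect_adjoint r Y Y' : adjoint_pair Y Y' ->
  adjoint_pair (partial_defect r Y) (partial_defect r Y').
Proof.
by move=> YY'; elim: r => //= i r IH; apply: adjoint_sub => //; exact: Phi_adjoint.
Qed.

Lemma partial_defect_linear r Y : linear Y -> linear (partial_defect r Y).
Proof.
move=> lY; elim: r => //= i r IH z x y.
by rewrite /= IH (Phi_linear i IH) opprD addrACA scalerBr.
Qed.

Lemma partial_defect_sum (A : Type) (s : seq A) (P : pred A) (T : A -> F -> F) r x :
  (forall a, P a -> linear (T a)) ->
  partial_defect r (fun y => \sum_(a <- s | P a) T a y) x =
  \sum_(a <- s | P a) partial_defect r (T a) x.
Proof.
move=> linT; elim: r x => //= i r IH x.
rewrite sumrB IH; congr (_ - _); rewrite PhiE.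
under eq_bigr do rewrite IH (lin_sum (lcreate_linear _)).
by rewrite exchange_big; apply: eq_bigr => a _; rewrite PhiE.
Qed.

Lemma partial_defectB r Y Z x :
  partial_defect r (Y \- Z) x = partial_defect r Y x - partial_defect r Z x.
Proof.
elim: r x => //= i r IH x.
have -> : Phi i (partial_defect r (Y \- Z)) x =
    Phi i (partial_defect r Y) x - Phi i (partial_defect r Z) x.
  rewrite !PhiE -sumrB; apply: eq_bigr => j _.
  by rewrite IH (linB (lcreate_linear _)).
by rewrite IH !opprD !opprK addrACA.
Qed.

(** Conjugation by an operator commuting with all creation operators passes
    through every Phi_i. *)
Lemma partial_defect_conj r (G G' : F -> F) Y : linear G ->
  (forall i (j : 'I_(n i)) x, G (lcreate j x) = lcreate j (G x)) ->
  (forall i (j : 'I_(n i)) x, G' (lannihilate j x) = lannihilate j (G' x)) ->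
  partial_defect r (G \o Y \o G') = G \o partial_defect r Y \o G'.
Proof.
move=> lG Gc Gc'; elim: r => //= i r ->; apply/funext => x /=.
rewrite (linB lG) !PhiE (lin_sum lG); congr (_ - _).
by apply: eq_bigr => j _; rewrite /= Gc Gc'.
Qed.

(** Removing factor i from the identity restricts vectors to the words whose
    i-th component is empty; after all factors only the vacuum remains. *)
Lemma partial_defect_id x :
  partial_defect (index_enum 'I_k) id x = x empty_word *: basis empty_word.
Proof.
have restr (r : seq 'I_k) : uniq r -> forall x w, partial_defect r id x w =
    if all (fun i => w i == [::]) r then x w else 0.
  elim: r => //= i r IH /andP[ir /IH{}IH] y w.
  rewrite -[LHS]/(partial_defect r id y w - Phi i (partial_defect r id) y w).
  rewrite IH; case wi: (w i) => [|j a]; first by rewrite Phi_nil// subr0.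
  rewrite (Phi_cons _ _ wi) IH.
  rewrite -[lannihilate j y _]/(y (lcons j (word_set w a))) (lcons_word_set wi).
  rewrite (_ : all (fun i => word_set w a i == [::]) r =
    all (fun i => w i == [::]) r) ?subrr//.
  apply: eq_in_all => i' i'r; rewrite word_set_out//.
  by apply: contraNneq ir => ->.
apply: l2P => w; rewrite restr ?index_enum_uniq//.
rewrite -[RHS]/(x empty_word * (w == empty_word)%:R).
have [->|w0] := eqVneq w empty_word.
  by rewrite mulr1 ifT//; apply/allP => i _; rewrite ffunE.
rewrite mulr0; case: allP => // wall; case/eqP: w0; apply: wordP => i.
by rewrite ffunE; apply/eqP/wall; exact: mem_index_enum.
Qed.

Lemma cvg_ext (x y : nat -> F) (l : F) : x =1 y -> y @ \oo --> l -> x @ \oo --> l.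
Proof. by move/funext->. Qed.

Lemma cvg_addH (x y : nat -> F) (l l' : F) : x @ \oo --> l -> y @ \oo --> l' ->
  (fun m => x m + y m) @ \oo --> l + l'.
Proof. exact: cvgD. Qed.

Lemma cvg_lcreate i (j : 'I_(n i)) (x : nat -> F) (l : F) :
  x @ \oo --> l -> (fun m => lcreate j (x m)) @ \oo --> lcreate j l.
Proof.
apply: (@cvg_bounded _ _ _ 1) => //; first exact: lcreate_linear.
by move=> y; rewrite mul1r nsq_lcreate.
Qed.

Lemma cvg_sumH (T : Type) (r : seq T) (f : T -> nat -> F) (a : T -> F) :
  (forall t, f t @ \oo --> a t) ->
  (fun m => \sum_(t <- r) f t m) @ \oo --> \sum_(t <- r) a t.
Proof.
move=> fa; elim: r => [|t r IH].
  have -> : (fun m => \sum_(t <- [::]) f t m) = (fun=> 0).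
    by apply/funext => m; rewrite big_nil.
  by rewrite big_nil; exact: cvg_cst.
have -> : (fun m => \sum_(t0 <- t :: r) f t0 m) =
    (fun m => f t m + \sum_(t <- r) f t m).
  by apply/funext => m; rewrite big_cons.
by rewrite big_cons; exact: cvgD.
Qed.

Lemma partial_defect_cvg r (A : nat -> F -> F) B :
  (forall x, (fun m => A m x) @ \oo --> B x) ->
  forall x, (fun m => partial_defect r (A m) x) @ \oo --> partial_defect r B x.
Proof.
move=> AB; elim: r => //= i r IH x; apply: cvgB; first exact: IH.
rewrite PhiE; apply: cvg_ext (fun m => PhiE _ _ _) _.
by apply: cvg_sumH => j; apply: cvg_lcreate; exact: IH.
Qed.

(** On a basis vector, Y = D + Phi_i(Y) expresses Y through D and through Y
    on a basis vector with one letter less, so finitely many values of D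
    determine Y; induction on the length of the i-th component. *)
Lemma partial_defect_basis_cvg0 r (A : nat -> F -> F) :
  (forall m, linear (A m)) ->
  (forall u, (fun m => partial_defect r (A m) (basis u)) @ \oo --> (0 : F)) ->
  forall u, (fun m => A m (basis u)) @ \oo --> (0 : F).
Proof.
move=> lA; elim: r => //= i r IH D0; apply: IH.
suff IHd d : forall u, (size (u i) <= d)%N ->
    (fun m => partial_defect r (A m) (basis u)) @ \oo --> (0 : F).
  by move=> u; exact: (IHd _ _ (leqnn _)).
have sum0 (f : 'I_(n i) -> nat -> F) : (forall j, f j @ \oo --> (0 : F)) ->
    (fun m => \sum_(j < n i) f j m) @ \oo --> (0 : F).
  by move=> f0; have := @cvg_sumH _ (index_enum 'I_(n i)) f (fun=> 0) f0; rewrite big1.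
have annihilated j u : (forall a, u i <> j :: a) ->
    (fun m => lcreate j (partial_defect r (A m) (lannihilate j (basis u))))
    @ \oo --> (0 : F).
  move=> uj; apply: (@cvg_ext _ (fun=> 0)) => [m|]; last exact: cvg_cst.
  rewrite lannihilate_basis_out// (lin0 (partial_defect_linear _ (lA _))).
  by rewrite (lin0 (lcreate_linear _)).
have step u : (forall j : 'I_(n i), (fun m => lcreate j
      (partial_defect r (A m) (lannihilate j (basis u)))) @ \oo --> (0 : F)) ->
    (fun m => partial_defect r (A m) (basis u)) @ \oo --> (0 : F).
  move=> /sum0 Phiu; have := cvg_addH (D0 u) Phiu; rewrite addr0; apply: cvg_ext => m.
  by rewrite /= -PhiE subrK.
elim: d => [|d IHd] u.
  rewrite leqn0 size_eq0 => /eqP ui.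
  by apply: step => j; apply: annihilated; rewrite ui.
move=> ud; apply: step => j.
have [[a ui]|/forallNP uj] := pselect (exists a, u i = j :: a); last first.
  exact: annihilated.
rewrite -(lin0 (lcreate_linear j)); apply: cvg_lcreate.
rewrite -(lcons_word_set ui) lannihilate_lcons; apply: IHd.
by rewrite word_set_at; move: ud; rewrite ui.
Qed.

End fock_defect.

(** * Right multipliers and the gauge group *)

Section right_multipliers.
Set Implicit Arguments.
Unset Strict Implicit.
Local Open Scope complex_scope.
Context {R : realType} {k : nat} {n : 'I_k -> nat}.
Local Notation C := R[i].
Local Notation F := (fock R n).
Local Notation W := (word n).
Local Notation basis := (@Defs.basis R W).
Local Notation shift := (@Defs.shift R W).
Implicit Types (x y f : F) (T : F -> F) (w u v : W) (d : 'I_k -> nat).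

Definition word_cat v w : W := finfun (fun i => v i ++ w i).

Lemma word_cat_inj w : injective (word_cat^~ w).
Proof.
move=> u v /ffunP uv; apply: wordP => i; have := uv i; rewrite !ffunE => uvi.
have /eqP : size (u i ++ w i) = size (v i ++ w i) by rewrite uvi.
rewrite !size_cat eqn_add2r => /eqP s.
by move/eqP: uvi; rewrite eqseq_cat// => /andP[/eqP].
Qed.

Lemma word_cat_lcons i (j : 'I_(n i)) v w :
  word_cat (lcons j v) w = lcons j (word_cat v w).
Proof.
apply: wordP => i'; rewrite ffunE.
have [<-|ii'] := eqVneq i i'; first by rewrite !lcons_at ffunE.
by rewrite !word_set_out// ffunE.
Qed.

Lemma word_cat0w w : word_cat empty_word w = w.
Proof. by apply: wordP => i; rewrite !ffunE. Qed.

Lemma rcreate_word_basis i (b : seq 'I_(n i)) v :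
  rcreate_word (rev b) (basis v) = basis (word_set v (v i ++ b)).
Proof.
elim/last_ind: b => [|b j IH] /=.
  congr Defs.basis; apply: wordP => i'.
  have [<-|ii'] := eqVneq i i'; first by rewrite word_set_at cats0.
  by rewrite word_set_out.
rewrite rev_rcons /= IH rcreate_basis; congr Defs.basis; apply: wordP => i'.
have [<-|ii'] := eqVneq i i'; last by rewrite !word_set_out.
by rewrite !word_set_at rcons_cat.
Qed.

Lemma rcreate_word_adjoint i (b : seq 'I_(n i)) :
  exists T', adjoint_pair (rcreate_word (R := R) b) T'.
Proof.
elim: b => [|j b [T' TT']] /=; first by exists id.
exists (T' \o coshift (@lrcons_inj k n i j)).
by apply: adjoint_comp TT'; exact: adjoint_shift.
Qed.

(** The reversal in the definition of the multiplier makes the product of right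
    creation operators append w itself. *)
Lemma rcreate_words w :
  \big[comp/id]_(i < k) rcreate_word (rev (w i)) = shift (@word_cat_inj w).
Proof.
have [T' TT'] : exists T',
    adjoint_pair (\big[comp/id]_(i < k) rcreate_word (R := R) (rev (w i))) T'.
  elim/big_ind: _ => [|T U [T' TT'] [U' UU']|i _]; first by exists id.
    by exists (U' \o T'); exact: adjoint_comp.
  exact: rcreate_word_adjoint.
apply: (adjoint_ext TT' (adjoint_shift _)) => v; rewrite shift_basis.
have comps (r : seq 'I_k) : uniq r ->
    (\big[comp/id]_(i <- r) rcreate_word (rev (w i))) (basis v) =
    basis (finfun (fun i => v i ++ if i \in r then w i else [::])).
  elim: r => [_|i r IH /= /andP[ir /IH{}IH]].
    by rewrite big_nil; congr Defs.basis; apply: wordP => i; rewrite ffunE cats0.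
  rewrite big_cons /= IH rcreate_word_basis; congr Defs.basis; apply: wordP => i'.
  rewrite [RHS]ffunE inE eq_sym.
  have [<-|ii'] /= := eqVneq i i'; last by rewrite word_set_out// ffunE.
  by rewrite word_set_at ffunE (negbTE ir) cats0.
rewrite comps ?index_enum_uniq//; congr Defs.basis.
by apply: wordP => i; rewrite !ffunE mem_index_enum.
Qed.

(** Homogeneity by support; unlike the expansion over tuples this is visibly
    stable under linear combinations. *)
Definition homogeneous_at d f := forall w, f w != 0 -> forall i, size (w i) = d i.

Lemma homogeneous_at0 d : homogeneous_at d 0.
Proof. by move=> w; rewrite eqxx. Qed.

Lemma homogeneous_atP d (z : C) f g : homogeneous_at d f -> homogeneous_at d g ->
  homogeneous_at d (z *: f + g).
Proof.
move=> df dg w; rewrite -[(_ + _ : F) w]/(z * f w + g w) => nz.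
have [f0|/df//] := eqVneq (f w) 0; have [g0|/dg//] := eqVneq (g w) 0.
by rewrite f0 g0 mulr0 addr0 eqxx in nz.
Qed.

Lemma homogeneous_atZ d (z : C) f : homogeneous_at d f -> homogeneous_at d (z *: f).
Proof.
move=> df; rewrite -[_ *: _]addr0; apply: homogeneous_atP => //.
exact: homogeneous_at0.
Qed.

Lemma homogeneous_at_sum d (A : Type) (r : seq A) (P : pred A) (f : A -> F) :
  (forall a, P a -> homogeneous_at d (f a)) ->
  homogeneous_at d (\sum_(a <- r | P a) f a).
Proof.
move=> df; elim/big_ind: _ => // [|f1 f2 d1 d2]; first exact: homogeneous_at0.
by rewrite -[f1]scale1r; exact: homogeneous_atP.
Qed.

Lemma homogeneous_at_basis w : homogeneous_at (fun i => size (w i)) (basis w).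
Proof. by move=> v /=; have [->//|_] := eqVneq v w; rewrite eqxx. Qed.

Lemma basis_coord w v : basis w v = (v == w)%:R.
Proof. by []. Qed.

Lemma l2_sum_coord (A : Type) (r : seq A) (P : pred A) (f : A -> F) w :
  (\sum_(a <- r | P a) f a) w = \sum_(a <- r | P a) f a w.
Proof. by rewrite -dot_basis dot_suml; apply: eq_bigr => a _; rewrite dot_basis. Qed.

Definition tuples_word d (t : {dffun forall i : 'I_k, (d i).-tuple 'I_(n i)}) : W :=
  finfun (fun i => tval (t i)).

Lemma homogeneous_ofP d f : homogeneous_of d f <-> homogeneous_at d f.
Proof.
split=> [[a ->]|df].
  apply: homogeneous_at_sum => t _; apply: homogeneous_atZ => w.
  rewrite basis_coord; set v := finfun _; have [-> _ i|_] := eqVneq w v.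
    by rewrite ffunE size_tuple.
  by rewrite eqxx.
exists (fun t => f (tuples_word t)); apply: l2P => w; rewrite l2_sum_coord.
have [fw0|fw] := eqVneq (f w) 0.
  rewrite fw0 big1// => t _; rewrite -[LHS]/(_ * (w == tuples_word t)%:R).
  by case: eqP => [<-|_]; rewrite ?fw0 ?mul0r ?mulr0.
have wd i : size (w i) == d i by apply/eqP/df.
pose t0 : {dffun forall i : 'I_k, (d i).-tuple 'I_(n i)} :=
  finfun (fun i => Tuple (wd i)).
have t0w : tuples_word t0 = w by apply: wordP => i; rewrite !ffunE.
rewrite (bigD1 t0)//= big1 ?addr0 => [|t tt0].
  by rewrite -[RHS]/(f (tuples_word t0) * (w == tuples_word t0)%:R) t0w eqxx mulr1.
rewrite -[LHS]/(_ * (w == tuples_word t)%:R).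
case: eqP => [wt|_]; last by rewrite mulr0.
case/eqP: tt0; apply/ffunP => i; apply: val_inj.
have := t0w; rewrite wt => /ffunP/(_ i); by rewrite !ffunE.
Qed.

Definition support f : set W := [set w | f w != 0].

Lemma homogeneous_finite d f : homogeneous_at d f -> finite_set (support f).
Proof.
move=> df; pose T : finType := {dffun forall i : 'I_k, (d i).-tuple 'I_(n i)}.
apply: (@sub_finite_set _ _ [set tuples_word t | t in [set: T]]); last first.
  exact/finite_image/finite_finset.
move=> w fw; have wd i : size (w i) == d i by apply/eqP/df.
exists (finfun (fun i => Tuple (wd i))) => //.
by apply: wordP => i; rewrite !ffunE.
Qed.

Lemma finite_support_sum f : finite_set (support f) ->
  f = \sum_(w <- fset_set (support f)) f w *: basis w.
Proof.
move=> fin; apply: l2P => v; rewrite l2_sum_coord.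
have [fv0|fv] := eqVneq (f v) 0.
  rewrite fv0 big1_seq// => w _; rewrite -[LHS]/(f w * (v == w)%:R).
  by case: eqP => [<-|_]; rewrite ?fv0 ?mul0r ?mulr0.
rewrite (bigD1_seq v)/= ?fset_uniq//; last by rewrite in_fset_set//; exact/mem_set.
rewrite -[X in X + _]/(f v * (v == v)%:R) eqxx mulr1 big1 ?addr0// => w wv.
by rewrite -[LHS]/(f w * (v == w)%:R) eq_sym (negbTE wv) mulr0.
Qed.

Section multiplier.
Context (f : F) (fin : finite_set (support f)).

Lemma tilde_RE x :
  tilde_R f x = \sum_(w <- fset_set (support f)) f w *: shift (@word_cat_inj w) x.
Proof.
rewrite /tilde_R fsbig_finite//; apply: eq_bigr => w _.
by rewrite rcreate_words.
Qed.

Lemma tilde_R_adjoint : adjoint_pair (tilde_R f) (adj (tilde_R f)).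
Proof.
have TT' := @adjoint_sum _ _ _ (fset_set (support f)) xpredT _ _
  (fun w _ => adjoint_scale (f w) (adjoint_shift (@word_cat_inj w))).
have /funext tE := tilde_RE; rewrite -tE in TT'.
by rewrite (adjE TT').
Qed.

Lemma tilde_R_linear : linear (tilde_R f).
Proof. exact: adjoint_linear tilde_R_adjoint. Qed.

Lemma tilde_R_lcreate i (j : 'I_(n i)) x :
  tilde_R f (lcreate j x) = lcreate j (tilde_R f x).
Proof.
rewrite !tilde_RE (lin_sum (lcreate_linear j)); apply: eq_bigr => w _.
rewrite (linZ (lcreate_linear j)); congr (_ *: _).
have cI : injective (fun v => lcons j (word_cat v w)).
  by move=> u v /lcons_inj/word_cat_inj.
suff : shift (@word_cat_inj w) \o lcreate j = lcreate j \o shift (@word_cat_inj w).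
  by move/(congr1 (fun T => T x)).
rewrite (shift_comp (@lcons_inj k n i j) (@word_cat_inj w) cI)//.
by apply: shift_comp => v /=; rewrite word_cat_lcons.
Qed.

Lemma adj_tilde_R_lannihilate i (j : 'I_(n i)) x :
  adj (tilde_R f) (lannihilate j x) = lannihilate j (adj (tilde_R f) x).
Proof.
apply: l2_eq => y.
rewrite !(adjoint_sym tilde_R_adjoint, adjoint_sym (lcreate_adjoint _)).
by rewrite tilde_R_lcreate.
Qed.

Lemma tilde_R_basis v :
  tilde_R f (basis v) = \sum_(w <- fset_set (support f)) f w *: basis (word_cat v w).
Proof. by rewrite tilde_RE; apply: eq_bigr => w _; rewrite shift_basis. Qed.

Lemma tilde_R_vacuum : tilde_R f (basis empty_word) = f.
Proof.
rewrite tilde_R_basis [RHS](finite_support_sum fin).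
by apply: eq_bigr => w _; rewrite word_cat0w.
Qed.

(** The multiplier commutes with the creation operators, so the defect falls
    on the identity, of which only the vacuum projection is left. *)
Lemma defect_tilde_R x :
  partial_defect (index_enum 'I_k) (tilde_R f \o adj (tilde_R f)) x = dot x f *: f.
Proof.
rewrite -[tilde_R f \o _]/(tilde_R f \o id \o adj (tilde_R f)).
rewrite partial_defect_conj; [|exact: tilde_R_linear|exact: tilde_R_lcreate|
  exact: adj_tilde_R_lannihilate].
rewrite /= partial_defect_id (linZ tilde_R_linear) tilde_R_vacuum.
by rewrite -dot_basis (adjoint_sym tilde_R_adjoint) tilde_R_vacuum.
Qed.

End multiplier.

Lemma tilde_R_homogeneous d f v : homogeneous_at d f ->
  homogeneous_at (fun i => size (v i) + d i)%N (tilde_R f (basis v)).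
Proof.
move=> df; rewrite (tilde_R_basis (homogeneous_finite df)).
rewrite big_seq_cond; apply: homogeneous_at_sum => w /andP[wf _].
apply: homogeneous_atZ => u uw i.
rewrite (homogeneous_at_basis uw) ffunE size_cat (df w)//.
by move: wf; rewrite in_fset_set => [/set_mem//|]; exact: homogeneous_finite df.
Qed.

Fact circle_conj_subproof (z : @circle R) : `|Num.conj (val z)| == 1.
Proof. by rewrite norm_conjC (eqP (valP z)). Qed.

Definition circle_conj (z : @circle R) : @circle R :=
  exist (fun z => is_true (`|z| == 1)) _ (circle_conj_subproof z).

Lemma gauge_adjoint (lam : 'I_k -> @circle R) :
  adjoint_pair (gauge (n := n) lam) (gauge (fun i => circle_conj (lam i))).
Proof.
move=> x y; rewrite /dot; congr csum; apply/funext => w /=.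
rewrite rmorphM mulrCA mulrA; congr (_ * _ * _).
rewrite /gauge_weight rmorph_prod; apply: eq_bigr => i _.
by rewrite rmorphXn /= conjCK.
Qed.

Lemma gauge_linear (lam : 'I_k -> @circle R) : linear (gauge (n := n) lam).
Proof. exact: adjoint_linear (gauge_adjoint lam). Qed.

(** Appending w multiplies the gauge weight by that of w, which is constant on
    the support of a homogeneous f. *)
Lemma gauge_tilde_R (lam : 'I_k -> @circle R) d f x : homogeneous_at d f ->
  gauge lam (tilde_R f x) =
  (\prod_(i < k) val (lam i) ^+ d i) *: tilde_R f (gauge lam x).
Proof.
move=> df; have fin := homogeneous_finite df.
rewrite !tilde_RE// (lin_sum (gauge_linear lam)) scaler_sumr.
rewrite big_seq_cond [RHS]big_seq_cond; apply: eq_bigr => w /andP[wf _].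
have fw : f w != 0 by move: wf; rewrite in_fset_set// => /set_mem.
rewrite (linZ (gauge_linear lam)) [RHS]scalerA mulrC -scalerA; congr (_ *: _).
have -> : gauge lam (shift (@word_cat_inj w) x) =
    (gauge lam \o shift (@word_cat_inj w)) x by [].
have -> : (\prod_(i < k) val (lam i) ^+ d i) *:
      shift (@word_cat_inj w) (gauge lam x) =
    ((fun y => (\prod_(i < k) val (lam i) ^+ d i) *: y) \o
    (shift (@word_cat_inj w) \o gauge lam)) x by [].
congr (_ x); apply: adjoint_ext.
- exact: adjoint_comp (gauge_adjoint lam) (adjoint_shift _).
- apply: adjoint_comp (adjoint_comp (adjoint_shift _) (gauge_adjoint lam)).
  exact: adjoint_scale adjoint_id.
move=> v /=; rewrite shift_basis !gauge_basis.
rewrite (linZ (adjoint_linear (adjoint_shift (@word_cat_inj w)))) shift_basis.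
rewrite scalerA -big_split; congr (_ *: _); apply: eq_bigr => i _ /=.
by rewrite ffunE size_cat exprD mulrC (df w).
Qed.

End right_multipliers.

(** * Gram-Schmidt orthonormalization of graded sequences *)

Section gram_schmidt.
Set Implicit Arguments.
Unset Strict Implicit.
Local Open Scope complex_scope.
Context {R : realType} {I : choiceType} {D : Type}.
Local Notation C := R[i].
Local Notation H := (l2 R I).
Context (V : D -> set H).
Context (V0 : forall d, V d 0).
Context (VP : forall d (z : C) x y, V d x -> V d y -> V d (z *: x + y)).
Context (Vorth : forall d d' x y, V d x -> V d' y -> d <> d' -> dot x y = 0).
Context (v : nat -> H) (lab : nat -> D) (Vv : forall l, V (lab l) (v l)).
Implicit Types (L : seq H) (x : H).

Definition residual L x := x - \sum_(g <- L) dot x g *: g.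

(** Vectors with zero residual are skipped, so that the list stays orthonormal
    and its length is the rank reached so far. *)
Definition gs_step L x :=
  if residual L x == 0 then L else rcons L (`|residual L x|^-1 *: residual L x).

Fixpoint gs m := if m is m'.+1 then gs_step (gs m') (v m') else [::].

Definition orthonormal_seq L := forall s t, (s < size L)%N -> (t < size L)%N ->
  dot (nth 0 L s) (nth 0 L t) = (s == t)%:R.

Lemma dot_seq_coef L (c : nat -> C) t : orthonormal_seq L -> (t < size L)%N ->
  dot (\sum_(s < size L) c s *: nth 0 L s) (nth 0 L t) = c t.
Proof.
move=> oL tL; rewrite dot_suml (bigD1 (Ordinal tL))//= dotZl oL// eqxx mulr1.
rewrite big1 ?addr0// => s st; rewrite dotZl oL//.
by rewrite -[_ == t]/(s == Ordinal tL) (negbTE st) mulr0.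
Qed.

Lemma residual_orth L x t : orthonormal_seq L -> (t < size L)%N ->
  dot (residual L x) (nth 0 L t) = 0.
Proof.
move=> oL tL; rewrite dotBl (big_nth 0) big_mkord.
by rewrite (dot_seq_coef (fun s => dot x (nth 0 L s))) ?subrr.
Qed.

Lemma gs_step_orthonormal L x : orthonormal_seq L -> orthonormal_seq (gs_step L x).
Proof.
move=> oL; rewrite /gs_step; case: eqP => // /eqP r0.
set r := residual L x in r0 *; set g := _ *: r.
have gL t : (t < size L)%N -> dot g (nth 0 L t) = 0.
  by move=> tL; rewrite dotZl residual_orth// mulr0.
have gg : dot g g = 1.
  have rC : (dot r r) = `|r| ^+ 2 by rewrite dotxx normH_sqr.
  by rewrite dotZl dotZr rC geC0_conj ?invr_ge0//; field; rewrite normr_eq0.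
move=> s t; rewrite size_rcons !ltnS !nth_rcons (leq_eqVlt s) (leq_eqVlt t).
move=> /orP[/eqP->|sL] /orP[/eqP->|tL]; rewrite ?ltnn ?eqxx ?sL ?tL.
- by rewrite gg.
- by rewrite gL// gtn_eqF.
- by rewrite (dot_swap (gL _ sL)) ltn_eqF.
- exact: oL.
Qed.

Lemma gs_orthonormal m : orthonormal_seq (gs m).
Proof. by elim: m => [|m IH] //=; exact: gs_step_orthonormal. Qed.

Lemma size_gs_step L x : (size L <= size (gs_step L x))%N.
Proof. by rewrite /gs_step; case: ifP => // _; rewrite size_rcons. Qed.

Lemma nth_gs_step L x s : (s < size L)%N -> nth 0 (gs_step L x) s = nth 0 L s.
Proof. by move=> sL; rewrite /gs_step; case: ifP => // _; rewrite nth_rcons sL. Qed.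

Lemma size_gs m m' : (m <= m')%N -> (size (gs m) <= size (gs m'))%N.
Proof.
move=> /subnK <-; elim: (m' - m)%N => // d IH; rewrite addSn /=.
exact: leq_trans IH (size_gs_step _ _).
Qed.

Lemma nth_gs m m' s : (s < size (gs m))%N -> (m <= m')%N ->
  nth 0 (gs m') s = nth 0 (gs m) s.
Proof.
move=> sm /subnK <-; elim: (m' - m)%N => // d IH; rewrite addSn /= nth_gs_step//.
by apply: leq_trans sm _; apply: size_gs; exact: leq_addl.
Qed.

Lemma gs_span l : v l =
  \sum_(s < size (gs l.+1)) dot (v l) (nth 0 (gs l.+1) s) *: nth 0 (gs l.+1) s.
Proof.
pose L := gs l; have oL := @gs_orthonormal l.
rewrite /= -/L /gs_step; case: eqP => [r0|/eqP r0].
  by move/eqP: r0; rewrite /residual subr_eq0 (big_nth 0) big_mkord => /eqP.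
set r := residual L (v l) in r0 *.
rewrite size_rcons big_ord_recr /= nth_rcons ltnn eqxx.
under eq_bigr do rewrite nth_rcons ltn_ord.
have -> : dot (v l) (`|r|^-1 *: r) *: (`|r|^-1 *: r) = r.
  have vr : dot (v l) r = dot r r.
    apply/eqP; rewrite -subr_eq0 -dotBl /r /residual opprB addrC subrK.
    rewrite dot_suml (big_nth 0) big_mkord big1// => s _.
    by rewrite dotZl (dot_swap (residual_orth _ oL _)) ?mulr0.
  rewrite dotZr vr dotxx -normH_sqr geC0_conj ?invr_ge0// scalerA.
  by rewrite -[RHS]scale1r; congr (_ *: _); field; rewrite normr_eq0.
by rewrite /r /residual (big_nth 0) big_mkord addrC subrK.
Qed.

Lemma gs_label m s : (s < size (gs m))%N -> exists d, V d (nth 0 (gs m) s).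
Proof.
elim: m s => // m IH s /=; rewrite /gs_step; case: eqP => [_|_]; first exact: IH.
rewrite size_rcons ltnS nth_rcons; case: ltngtP => // [sL _|_ _]; first exact: IH.
have VZ d z x : V d x -> V d (z *: x).
  by move=> Vx; rewrite -[_ *: _]addr0; exact: VP.
have VD d x y : V d x -> V d y -> V d (x + y).
  by move=> Vx Vy; rewrite -[x]scale1r; exact: VP.
exists (lab m); apply: (VZ); apply: (VD) => //; rewrite -scaleN1r; apply: (VZ).
rewrite (big_nth 0) big_mkord; elim/big_ind: _ => // [x y|t _]; first exact: VD.
have [d Vd] := IH t (ltn_ord t).
have [<-|dlab] := pselect (d = lab m); first exact: VZ.
by rewrite (dot_swap (Vorth Vd (Vv m) dlab)) scale0r.
Qed.

(** A residual only subtracts multiples of earlier vectors with the same label,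
    since those with other labels are orthogonal; hence labels survive the
    process. N is the largest length of the lists [gs m], if there is one. *)
Theorem graded_gram_schmidt : exists (N : option nat) (psi : nat -> H),
  [/\ forall s, index_lt s N -> exists d, V d (psi s),
      forall s t, index_lt s N -> index_lt t N -> dot (psi s) (psi t) = (s == t)%:R
    & forall l, exists q, forall m, (q <= m)%N ->
        \sum_(s < m | index_lt s N) dot (v l) (psi s) *: psi s = v l].
Proof.
have [N NP] : exists N, forall s, index_lt s N <-> exists m, (s < size (gs m))%N.
  have [bd|unb] := pselect (exists b, forall m, (size (gs m) <= b)%N); last first.
    exists None => s; split=> // _; apply: contrapT => /forallNP h; apply: unb.
    by exists s => m; have /negP := h m; rewrite -leqNgt.
  have [b bP] := bd.
  have ex0 : exists q, `[< exists m, size (gs m) = q >].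
    by exists 0%N; apply/asboolP; exists 0%N.
  have qb q : `[< exists m, size (gs m) = q >] -> (q <= b)%N.
    by move=> /asboolP[m <-].
  case: (ex_maxnP ex0 qb) => q /asboolP[m mq] qmax.
  exists (Some q) => s /=; split=> [sq|[m' sm']]; first by exists m; rewrite mq.
  by apply: leq_trans sm' _; apply: qmax; apply/asboolP; exists m'.
have [psi psiE] : exists psi : nat -> H, forall m s, (s < size (gs m))%N ->
    psi s = nth 0 (gs m) s.
  pose st s := xget 0%N [set m | (s < size (gs m))%N].
  exists (fun s => nth 0 (gs (st s)) s) => m s sm.
  have sst : (s < size (gs (st s)))%N.
    exact: (@xgetI _ 0%N [set m | (s < size (gs m))%N] m sm).
  case: (leqP (st s) m) => [|/ltnW] h; first by rewrite (nth_gs sst h).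
  by rewrite (nth_gs sm h).
have opsi s t : index_lt s N -> index_lt t N -> dot (psi s) (psi t) = (s == t)%:R.
  move=> /NP[a sa] /NP[b tb].
  have sm : (s < size (gs (maxn a b)))%N.
    by apply: leq_trans sa _; apply: size_gs; exact: leq_maxl.
  have tm : (t < size (gs (maxn a b)))%N.
    by apply: leq_trans tb _; apply: size_gs; exact: leq_maxr.
  by rewrite (psiE _ _ sm) (psiE _ _ tm) gs_orthonormal.
exists N, psi; split=> // [s /NP[m sm]|l].
  by rewrite (psiE _ _ sm); exact: gs_label sm.
set q := size (gs l.+1); exists q => m qm.
have vE : v l = \sum_(0 <= s < q) dot (v l) (psi s) *: psi s.
  rewrite big_mkord {1}gs_span; apply: eq_bigr => s _.
  by rewrite (psiE l.+1).
have ltN s : (s < q)%N -> index_lt s N by move=> sq; apply/NP; exists l.+1.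
rewrite -(big_mkord (fun s => index_lt s N) (fun s => dot (v l) (psi s) *: psi s)).
rewrite (big_cat_nat _ qm)//= [X in _ + X]big_nat_cond [X in _ + X]big1 ?addr0; last first.
  move=> s /andP[/andP[qs _] sN].
  rewrite {1}vE dot_suml big_nat big1 ?scale0r// => t tq.
  rewrite dotZl opsi//; last exact: ltN.
  by rewrite ltn_eqF ?mulr0//; exact: leq_trans qs.
rewrite [RHS]vE big_nat_cond [RHS]big_nat_cond; apply: eq_bigl => s.
by case: ltnP => //= sq; rewrite ltN.
Qed.

End gram_schmidt.

(** * Graded projections with positive defect *)

Section graded_projections.
Set Implicit Arguments.
Unset Strict Implicit.
Local Open Scope complex_scope.
Context {R : realType} {k : nat} {n : 'I_k -> nat}.
Local Notation C := R[i].
Local Notation F := (fock R n).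
Local Notation W := (word n).
Local Notation basis := (@Defs.basis R W).
Local Notation proj := Defs.proj.
Implicit Types (x y f : F) (Y T Q E : F -> F) (w u v : W) (d : 'I_k -> nat)
  (M : set F).

(** An m-th root of -1 with m the difference of the exponents. *)
Lemma circle_separates (a b : nat) : a != b ->
  exists z : @circle R, val z ^+ a != val z ^+ b.
Proof.
wlog ab : a b / (a < b)%N => [hw|_].
  rewrite neq_ltn => /orP[ab|ba]; first by apply: hw => //; rewrite ltn_eqF.
  by have [|z] := hw b a ba; [rewrite ltn_eqF|rewrite eq_sym; exists z].
have m0 : (0 < b - a)%N by rewrite subn_gt0.
pose z : C := (b - a)%N.-root (-1).
have zm : z ^+ (b - a) = -1 by exact: rootCK.
have z1 : `|z| == 1.
  by rewrite -(@pexpr_eq1 _ _ (b - a)) -?lt0n// -normrX zm normrN1.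
exists (exist (fun z => is_true (`|z| == 1)) z z1) => /=.
have z0 : z != 0 by rewrite -normr_eq0 (eqP z1) oner_neq0.
rewrite -(subnK (ltnW ab)) exprD zm mulN1r -subr_eq0 opprK -mulr2n mulrn_eq0 /=.
by rewrite expf_neq0.
Qed.

Lemma graded_proj_commutes M lam x : closed_subspace M -> graded M ->
  proj M (gauge lam x) = gauge lam (proj M x).
Proof.
move=> clM gM; apply: proj_unique => //; first by apply: gM; exact: proj_mem.
move=> m Mm; rewrite -(linB (gauge_linear lam)) gauge_adjoint.
by apply: proj_orth => //; exact: gM.
Qed.

Definition degree_preserving Y :=
  forall u, homogeneous_at (fun i => size (u i)) (Y (basis u)).

(** P commutes with the gauge group, so it preserves its joint eigenspaces,
    which are the spaces of fixed multi-degree. *)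
Lemma graded_proj_degree M : closed_subspace M -> graded M ->
  degree_preserving (proj M).
Proof.
move=> clM gM u w nz i; apply/eqP; apply: contraT => /circle_separates[z zne].
have one1 : `|1 : C| == 1 by rewrite normr1.
pose one : @circle R := exist (fun z => is_true (`|z| == 1)) 1 one1.
(* Rotating the i-th variable alone isolates the i-th degree. *)
pose lam i' := if i' == i then z else one.
have weight v : gauge_weight lam v = val z ^+ size (v i).
  rewrite /gauge_weight (bigD1 i)//= big1 ?mulr1 => [|i' ii'].
    by rewrite /lam eqxx.
  by rewrite /lam (negbTE ii') /= expr1n.
have := graded_proj_commutes lam (basis u) clM gM.
rewrite gauge_basis -[\prod_(i < k) _]/(gauge_weight lam u) weight.
rewrite (linZ (adjoint_linear (proj_orth_projection clM).1)).
move/(congr1 (fun x : F => x w)).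
rewrite -[X in X = _]/(val z ^+ size (u i) * proj M (basis u) w).
rewrite -[X in _ = X]/(gauge_weight lam w * proj M (basis u) w) weight.
by move/(mulIf nz) => zE; rewrite zE eqxx in zne.
Qed.

Lemma homogeneous_at_lcreate d i (j : 'I_(n i)) f :
  homogeneous_at d f -> homogeneous_at (fun i' => (i' == i) + d i')%N (lcreate j f).
Proof.
move=> df w nz i'.
have [[a wi]|/forallNP wi] := pselect (exists a, w i = j :: a); last first.
  by rewrite lcreate_out ?eqxx in nz.
rewrite (lcreate_at _ wi) in nz; have := df _ nz i'.
have [->|i'i] := eqVneq i' i; first by rewrite word_set_at wi => /= ->.
by rewrite word_set_out 1?eq_sym.
Qed.

Lemma Phi_degree_preserving i Y : linear Y -> degree_preserving Y ->
  degree_preserving (Phi i Y).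
Proof.
move=> lY dY u; rewrite PhiE; apply: homogeneous_at_sum => j _.
have [[a ui]|/forallNP ui] := pselect (exists a, u i = j :: a); last first.
  rewrite lannihilate_basis_out// (lin0 lY) (lin0 (lcreate_linear _)).
  exact: homogeneous_at0.
rewrite -(lcons_word_set ui) lannihilate_lcons.
move: (word_set u a) => v w /(homogeneous_at_lcreate (dY v)) h i'.
rewrite h; have [->|i'i] := eqVneq i' i; first by rewrite lcons_at.
by rewrite word_set_out 1?eq_sym.
Qed.

Lemma degree_preservingB Y Z : degree_preserving Y -> degree_preserving Z ->
  degree_preserving (Y \- Z).
Proof.
move=> dY dZ u; rewrite -[(Y \- Z) _]/(Y (basis u) - Z (basis u)) addrC -scaleN1r.
exact: homogeneous_atP.
Qed.

Lemma partial_defect_degree r Y : linear Y -> degree_preserving Y ->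
  degree_preserving (partial_defect r Y).
Proof.
move=> lY dY; elim: r => //= i r IH; apply: degree_preservingB => //.
by apply: Phi_degree_preserving => //; exact: partial_defect_linear.
Qed.

(** A class of vectors that contains the homogeneous ones and is stable under
    the adjoints of creation operators, so that inductions on the degree stay
    inside it and terminate. *)
Definition bounded_degree x :=
  exists d : nat, forall w, x w != 0 -> forall i, (size (w i) <= d)%N.

Lemma homogeneous_bounded d x : homogeneous_at d x -> bounded_degree x.
Proof.
move=> dx; exists (\sum_i d i)%N => w /dx dw i.
by rewrite dw (bigD1 i)//= leq_addr.
Qed.

Definition positive_on_bounded Y :=
  forall x, bounded_degree x -> 0 <= dot (Y x) x.

(** Write <Y x, x> as <(Y - Phi_i(Y))x, x> plus the sum of the <Y y, y> with
    y = S_ij^* x, whose i-th degrees are smaller. *)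
Lemma positive_on_bounded_Phi i Y : positive_on_bounded (Y \- Phi i Y) ->
  positive_on_bounded Y.
Proof.
move=> pD x [d xd].
have [e] : exists e, forall w, x w != 0 -> (size (w i) < e)%N.
  by exists d.+1 => w /xd h; rewrite ltnS.
elim: e x xd => [|e IH] x xd xe.
  suff -> : x = 0 by rewrite dot0r.
  by apply: l2P => w; apply/eqP; apply: contraT => /xe.
have -> : dot (Y x) x = dot ((Y \- Phi i Y) x) x + dot (Phi i Y x) x.
  by rewrite -dotDl /= subrK.
rewrite addr_ge0//; first by apply: pD; exists d.
rewrite Phi_dot sumr_ge0// => j _; apply: IH => w xw; last first.
  by have := xe (lcons j w) xw; rewrite lcons_at ltnS.
move=> i'; apply: leq_trans (xd (lcons j w) xw i').
have [<-|ii'] := eqVneq i i'; first by rewrite lcons_at /=.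
by rewrite word_set_out.
Qed.

Lemma positive_on_bounded_partial r Y :
  positive_on_bounded (partial_defect r Y) -> positive_on_bounded Y.
Proof. by elim: r => //= i r IH /positive_on_bounded_Phi. Qed.

Lemma orth_projectionB Q E : orth_projection Q -> orth_projection E ->
  (forall x, Q (E x) = E x) -> orth_projection (Q \- E).
Proof.
move=> [QQ Qid] [EE Eid] QE; split=> [|x /=]; first exact: adjoint_sub.
have EQ y : E (Q y) = E y by apply: l2_eq => z; rewrite EE QQ QE EE.
rewrite (linB (adjoint_linear QQ)) (linB (adjoint_linear EE)).
by rewrite Qid QE EQ Eid subrr subr0.
Qed.

Lemma Phi_orth_projection i Q : orth_projection Q -> orth_projection (Phi i Q).
Proof.
case=> QQ Qid; split; first exact: Phi_adjoint.
move=> x; apply: l2P => w; case wi: (w i) => [|j a]; first by rewrite !Phi_nil.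
suff -> : Phi i Q (Phi i Q x) w = Q (Q (lannihilate j x)) (word_set w a).
  by rewrite Qid (Phi_cons _ _ wi).
rewrite (Phi_cons _ _ wi); congr (l2_val (Q _) _); apply: l2P => v.
rewrite -[LHS]/(Phi i Q x (lcons j v)).
by rewrite (Phi_cons _ _ (lcons_at v j)) word_set_lcons.
Qed.

(** Positivity of Q - E for two projections forces |Q y| >= |y| on the range
    of E, hence Q E = E. As Q preserves degrees, it is enough to use this for
    y = E e_u, which has bounded degree. *)
Lemma orth_projection_defect i Q : orth_projection Q -> degree_preserving Q ->
  positive_on_bounded (Q \- Phi i Q) -> orth_projection (Q \- Phi i Q).
Proof.
move=> pQ dQ pos; have pE := Phi_orth_projection i pQ.
have [[QQ Qid] [EE Eid]] := (pQ, pE).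
apply: orth_projectionB => // x.
suff QE : Q \o Phi i Q = Phi i Q by exact: (congr1 (fun T => T x) QE).
apply: adjoint_ext (adjoint_comp QQ EE) EE _ => u /=.
set y := Phi i Q (basis u).
have yb : bounded_degree y.
  have dE : degree_preserving (Phi i Q).
    by apply: Phi_degree_preserving => //; exact: adjoint_linear QQ.
  exact: homogeneous_bounded (dE u).
have := pos _ yb; rewrite [X in dot X _]/= Eid dotBl (orth_projection_dot _ pQ) dotxx.
rewrite -rmorphB lecR => Qy.
apply/eqP; rewrite eq_sym -subr_eq0; apply/eqP/nsq_eq0/le_anti.
rewrite nsq_ge0 andbT nsqB dotC (orth_projection_dot _ pQ) /=.
move: Qy; lra.
Qed.

Lemma orth_projection_partial_defect r Y : orth_projection Y ->
  degree_preserving Y -> positive_on_bounded (partial_defect r Y) ->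
  orth_projection (partial_defect r Y).
Proof.
move=> pY dY; elim: r => //= i r IH pos.
apply: orth_projection_defect => //.
  exact/IH/positive_on_bounded_Phi/pos.
by apply: partial_defect_degree => //; exact: adjoint_linear pY.1.
Qed.

Lemma partial_defect_mem M r x : invariant_subspace M ->
  M (partial_defect r (proj M) x).
Proof.
case=> clM Minv; elim: r x => [|i r IH] x /=; first exact: proj_mem.
apply: subspaceB => //; rewrite PhiE; apply: subspace_sum => // j _.
exact: Minv.
Qed.

End graded_projections.

(** * The multipliers of an orthonormal family of wandering vectors *)

Section wandering.
Set Implicit Arguments.
Unset Strict Implicit.
Local Open Scope complex_scope.
Context {R : realType} {k : nat} {n : 'I_k -> nat}.
Local Notation C := R[i].
Local Notation F := (fock R n).
Local Notation W := (word n).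
Local Notation basis := (@Defs.basis R W).
Local Notation proj := Defs.proj.
Implicit Types (x y f : F) (w u v : W) (M : set F).

Lemma tilde_R_mem M f w : invariant_subspace M -> finite_set (support f) ->
  M f -> M (tilde_R f (basis w)).
Proof.
move=> [clM Minv] fin Mf; elim/(@word_ind k n): w => [|i j w IH].
  by rewrite tilde_R_vacuum.
by rewrite -[basis _](lcreate_basis j w) tilde_R_lcreate//; exact: Minv.
Qed.

(** G_f e_w is obtained from f = G_f e_0 by left creation operators, which are
    isometric. *)
Lemma nsq_tilde_R_basis f w : finite_set (support f) ->
  nsq (tilde_R f (basis w)) = nsq f.
Proof.
move=> fin; elim/(@word_ind k n): w => [|i j w IH]; first by rewrite tilde_R_vacuum.
by rewrite -[basis _](lcreate_basis j w) tilde_R_lcreate// nsq_lcreate.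
Qed.

Lemma nsq_basis w : nsq (basis w) = 1.
Proof. by rewrite /nsq dot_basis basis_coord eqxx. Qed.

Lemma eq_basis x w : nsq x <= 1 -> x w = 1 -> x = basis w.
Proof.
move=> x1 xw; apply/eqP; rewrite -subr_eq0; apply/eqP/nsq_eq0/le_anti.
rewrite nsq_ge0 andbT nsqB nsq_basis dot_basis xw /=; lra.
Qed.

Section partial_sums.
Context (N : option nat) (psi : nat -> F).

Definition range_sum m x :=
  \sum_(s < m | index_lt s N) tilde_R (psi s) (adj (tilde_R (psi s)) x).

Definition rank_one_sum m x := \sum_(s < m | index_lt s N) dot x (psi s) *: psi s.

Context (fin : forall s, index_lt s N -> finite_set (support (psi s))).

Lemma range_sum_adjoint m : adjoint_pair (range_sum m) (range_sum m).
Proof.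
apply: adjoint_sum => s sN.
apply: (@adjoint_comp _ _ (tilde_R (psi s)) (adj (tilde_R (psi s)))).
  exact: tilde_R_adjoint (fin sN).
exact: adjoint_sym (tilde_R_adjoint (fin sN)).
Qed.

Lemma defect_range_sum m x :
  partial_defect (index_enum 'I_k) (range_sum m) x = rank_one_sum m x.
Proof.
rewrite /range_sum partial_defect_sum => [|s sN].
  by apply: eq_bigr => s sN; exact: (defect_tilde_R (fin sN)).
apply: (@adjoint_linear _ _ _ (tilde_R (psi s) \o adj (tilde_R (psi s)))).
apply: (@adjoint_comp _ _ (tilde_R (psi s)) (adj (tilde_R (psi s)))).
  exact: tilde_R_adjoint (fin sN).
exact: adjoint_sym (tilde_R_adjoint (fin sN)).
Qed.

Lemma dot_range_sum m x : dot (range_sum m x) x =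
  \sum_(s < m | index_lt s N) (nsq (adj (tilde_R (psi s)) x))%:C.
Proof.
rewrite dot_suml; apply: eq_bigr => s sN.
by rewrite (tilde_R_adjoint (fin sN)) dotxx.
Qed.

Context (ortho : forall s t, index_lt s N -> index_lt t N ->
  dot (psi s) (psi t) = (s == t)%:R).

Lemma dot_rank_one_sum m x s : index_lt s N -> (s < m)%N ->
  dot (rank_one_sum m x) (psi s) = dot x (psi s).
Proof.
move=> sN sm; rewrite dot_suml (bigD1 (Ordinal sm))//= dotZl ortho// eqxx mulr1.
rewrite big1 ?addr0// => t /andP[tN ts]; rewrite dotZl ortho//.
by rewrite -[_ == s]/(t == Ordinal sm) (negbTE ts) mulr0.
Qed.

Lemma rank_one_sum_orth_projection m : orth_projection (rank_one_sum m).
Proof.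
split=> [x y|x].
  rewrite dot_suml dot_sumr; apply: eq_bigr => s _.
  by rewrite dotZl dotZr [dot (psi s) y]dotC mulrC.
by apply: eq_bigr => s sN; rewrite dot_rank_one_sum.
Qed.

Context (M : set F) (M_inv : invariant_subspace M).
Context (psiM : forall s, index_lt s N -> M (psi s)).
Context (hom : forall s, index_lt s N -> exists d, homogeneous_at d (psi s)).
Let Delta := partial_defect (index_enum 'I_k) (proj M).
Context (pD : orth_projection Delta).
Context (Dpsi : forall s, index_lt s N -> Delta (psi s) = psi s).

(** The defect of P minus the partial sum is Delta minus one of its
    subprojections. *)
Lemma range_sum_le m : positive_on_bounded (proj M \- range_sum m).
Proof.
apply: (@positive_on_bounded_partial _ _ _ (index_enum 'I_k)) => x _.
have -> : partial_defect (index_enum 'I_k) (proj M \- range_sum m) x =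
    (Delta \- rank_one_sum m) x.
  by rewrite partial_defectB defect_range_sum.
rewrite orth_projection_dot ?lecR ?nsq_ge0//.
apply: orth_projectionB => // [|y]; first exact: rank_one_sum_orth_projection.
rewrite (lin_sum (adjoint_linear pD.1)); apply: eq_bigr => s sN.
by rewrite (linZ (adjoint_linear pD.1)) Dpsi.
Qed.

(** Test [range_sum_le] on the unit vector x = G_s e_w of M: the numbers
    |G_t^* x|^2 add up to at most 1, and the one for t = s is at least 1
    because G_s^* x has coordinate |x|^2 = 1 at w. *)
Lemma tilde_R_orthonormal s t w : index_lt s N -> index_lt t N ->
  adj (tilde_R (psi t)) (tilde_R (psi s) (basis w)) = (s == t)%:R *: basis w.
Proof.
move=> sN tN; set x := tilde_R (psi s) (basis w).
have nx : nsq x = 1.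
  rewrite nsq_tilde_R_basis; last exact: fin.
  by rewrite /nsq ortho// eqxx.
have Mx : M x by apply: tilde_R_mem => //; [exact: fin|exact: psiM].
have xb : bounded_degree x.
  by have [d dpsi] := hom sN; exact: homogeneous_bounded (tilde_R_homogeneous dpsi).
pose a r := nsq (adj (tilde_R (psi r)) x).
have suma m : \sum_(r < m | index_lt r N) a r <= 1.
  have := range_sum_le m xb; rewrite /= dotBl proj_id//; last by case: M_inv.
  by rewrite dot_range_sum dotxx -rmorph_sum -rmorphB lecR nx subr_ge0.
(* The coordinate at w is <x, G_s e_w> = |x|^2. *)
have zw : adj (tilde_R (psi s)) x w = 1.
  rewrite -dot_basis (adjoint_sym (tilde_R_adjoint (fin sN))) -/x dotxx nx.
  by [].
have as1 : 1 <= a s.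
  by apply: le_trans (coord_le_nsq _ w); rewrite zw normc1 expr1n.
have a_le r m : index_lt r N -> (r < m)%N -> a r <= 1.
  move=> rN rm; apply: le_trans (suma m); rewrite (bigD1 (Ordinal rm))//= lerDl.
  by apply: sumr_ge0 => ? _; exact: nsq_ge0.
have [<-|st] := eqVneq s t.
  by rewrite scale1r; apply: eq_basis zw; exact: (a_le s s.+1).
rewrite scale0r; apply: nsq_eq0; apply: le_anti; rewrite nsq_ge0 andbT.
pose m := (maxn s t).+1.
have sm : (s < m)%N by rewrite ltnS leq_maxl.
have tm : (t < m)%N by rewrite ltnS leq_maxr.
have st1 : a s + a t <= 1.
  apply: le_trans (suma m); rewrite (bigD1 (Ordinal sm))//= (bigD1 (Ordinal tm))/=.
    by rewrite addrA lerDl; apply: sumr_ge0 => ? _; exact: nsq_ge0.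
  by rewrite tN -val_eqE /= eq_sym.
suff : a t <= 0 by [].
by move: (a s) (a t) as1 st1 => p q; lra.
Qed.

Lemma adj_tilde_R_mul s t : index_lt s N -> index_lt t N ->
  forall x, adj (tilde_R (psi t)) (tilde_R (psi s) x) = (s == t)%:R *: x.
Proof.
move=> sN tN x.
have [As At] := (tilde_R_adjoint (fin sN), tilde_R_adjoint (fin tN)).
suff E : adj (tilde_R (psi t)) \o tilde_R (psi s) = (fun x => (s == t)%:R *: x).
  exact: (congr1 (fun T => T x) E).
apply: adjoint_ext (adjoint_comp (adjoint_sym At) As) (adjoint_scale _ adjoint_id) _.
by move=> w; exact: tilde_R_orthonormal.
Qed.

Lemma tilde_R_isometric s : index_lt s N -> isometric (tilde_R (psi s)).
Proof.
move=> sN x; apply/normH_eq; rewrite /nsq (tilde_R_adjoint (fin sN)).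
by rewrite adj_tilde_R_mul// eqxx scale1r.
Qed.

Lemma tilde_R_orthogonal s t : index_lt s N -> index_lt t N -> s <> t ->
  orthogonal_ranges (tilde_R (psi s)) (tilde_R (psi t)).
Proof.
move=> sN tN /eqP st x y; rewrite (tilde_R_adjoint (fin sN)).
by rewrite adj_tilde_R_mul// eq_sym (negbTE st) scale0r dot0r.
Qed.

Lemma range_sum_orth_projection m : orth_projection (range_sum m).
Proof.
split=> [|x]; first exact: range_sum_adjoint.
apply: eq_bigr => s sN; congr tilde_R.
have As := tilde_R_adjoint (fin sN).
rewrite (lin_sum (adjoint_linear (adjoint_sym As))).
rewrite (eq_bigr (fun t : 'I_m => (t == s)%:R *: adj (tilde_R (psi t)) x)).
  rewrite (bigD1 s)//= eqxx scale1r big1 ?addr0// => t /andP[_ /negbTE ->].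
  exact: scale0r.
by move=> t tN; exact: adj_tilde_R_mul tN sN _.
Qed.

(** The difference with P is uniformly bounded, so basis vectors suffice; on
    those, convergence is inherited from the defects. *)
Lemma range_sum_cvg :
  (forall u, (fun m => rank_one_sum m (basis u)) @ \oo --> Delta (basis u)) ->
  forall x, (fun m => range_sum m x) @ \oo --> proj M x.
Proof.
move=> sumD x; have clM : closed_subspace M by case: M_inv.
have pM := proj_orth_projection clM.
have lA m : linear (proj M \- range_sum m).
  exact: adjoint_linear (adjoint_sub pM.1 (range_sum_adjoint m)).
suff : (fun m => (proj M \- range_sum m) x) @ \oo --> (0 : F).
  by move=> /cvgHP h; apply/cvgHP => e /h; apply: filterS => m; rewrite sub0r nsqN.
apply: (@strong_cvg0 _ _ (fun m => proj M \- range_sum m) 4) => // [m y|].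
  apply: le_trans (nsqD_le _ _) _; rewrite nsqN.
  have := orth_projection_contr y pM.
  have := orth_projection_contr y (range_sum_orth_projection m); lra.
apply: (@partial_defect_basis_cvg0 _ _ _ (index_enum 'I_k)
  (fun m => proj M \- range_sum m)) => // u.
move/cvgHP: (sumD u) => h; apply/cvgHP => e /h; apply: filterS => m.
by rewrite partial_defectB defect_range_sum sub0r nsqN.
Qed.

End partial_sums.
End wandering.

(** * Dimension and rank *)

Section dimension.
Set Implicit Arguments.
Unset Strict Implicit.
Local Open Scope complex_scope.
Context {R : realType} {I : choiceType}.
Local Notation C := R[i].
Local Notation H := (l2 R I).

Lemma lin_indep_le_dimension (K : set H) m l (w : 'I_l -> H) :
  dimension_is K m -> lin_indep w -> (forall j, K (w j)) -> (l <= m)%N.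
Proof.
move=> [v [_ KE]] wI wK.
have /choice[c cE] : forall j, exists c : 'I_m -> C, \sum_i c i *: v i = w j.
  by move=> j; have := wK j; rewrite KE => -[c _ cE]; exists c.
pose A : 'M[C]_(l, m) := \matrix_(j, i) c j i.
suff /eqP <- : row_free A by exact: rank_leq_col.
apply: inj_row_free => r rA; apply/rowP => j; rewrite mxE.
apply: (wI (fun j => r 0 j)); under eq_bigr do rewrite -cE scaler_sumr.
rewrite exchange_big big1// => i _; under eq_bigr do rewrite scalerA.
rewrite -scaler_suml; have /rowP/(_ i) := rA; rewrite !mxE => rAi.
by rewrite (eq_bigr (fun j => r 0 j * A j i)) ?rAi ?scale0r// => t _; rewrite mxE.
Qed.

Lemma dimension_is_inj (K : set H) m m' :
  dimension_is K m -> dimension_is K m' -> m = m'.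
Proof.
have le a b : dimension_is K a -> dimension_is K b -> (a <= b)%N.
  move=> [v [vI KE]] Kb; apply: (lin_indep_le_dimension Kb vI) => j.
  rewrite KE; exists (fun i => (i == j)%:R) => //.
  rewrite (bigD1 j)//= eqxx scale1r big1 ?addr0// => i /negbTE ->.
  by rewrite scale0r.
by move=> Km Km'; apply/eqP; rewrite eqn_leq !le.
Qed.

Lemma orthonormal_lin_indep (psi : nat -> H) m :
  (forall s t, (s < m)%N -> (t < m)%N -> dot (psi s) (psi t) = (s == t)%:R) ->
  lin_indep (fun i : 'I_m => psi i).
Proof.
move=> ortho c c0 i; have := congr1 (fun x => dot x (psi i)) c0.
rewrite dot0l dot_suml (bigD1 i)//= dotZl ortho// eqxx mulr1 big1 ?addr0// => j ji.
by rewrite dotZl ortho// -[_ == _ :> nat]/(j == i) (negbTE ji) mulr0.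
Qed.

Lemma sums_to_unique N (x : nat -> H) (l l' : H) :
  sums_to N x l -> sums_to N x l' -> l = l'.
Proof. by move=> xl xl'; exact: (cvg_unique _ xl xl'). Qed.

(** Both cases reduce to counting linearly independent vectors in the range:
    the psi_s are such, and for finite N they span it. *)
Lemma rank_orthonormal_expansion (T : H -> H) (N : option nat) (psi : nat -> H) :
  (forall s t, index_lt s N -> index_lt t N -> dot (psi s) (psi t) = (s == t)%:R) ->
  (forall x, sums_to N (fun s => dot x (psi s) *: psi s) (T x)) ->
  (forall s, index_lt s N -> T (psi s) = psi s) ->
  linear T ->
  N = rank T.
Proof.
case: N => [m|] ortho TE Tpsi linT; rewrite /rank.
  have dimT : dimension_is (range T) m.
    exists (fun i : 'I_m => psi i); split; first exact: orthonormal_lin_indep.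
    apply/seteqP; split=> [_ [x _ <-]|_ [c _ <-]].
      exists (fun i => dot x (psi i)) => //.
      have : (fun q => \sum_(s < q | (s < m)%N) dot x (psi s) *: psi s) @ \oo
          --> \sum_(i < m) dot x (psi i) *: psi i.
        apply: cvg_near_cst; exists m => // q /= mq.
        rewrite (big_ord_widen_cond q xpredT (fun s => dot x (psi s) *: psi s))//.
      by move=> h; exact: (@sums_to_unique (Some m) _ _ _ h (TE x)).
    exists (\sum_(i < m) c i *: psi i) => //.
    rewrite (lin_sum linT); apply: eq_bigr => i _.
    by rewrite (linZ linT) (Tpsi _ (ltn_ord i)).
  apply/esym; apply: xget_unique; first by exists m.
  by move=> _ [m' dimT' <-]; congr Some; exact: dimension_is_inj dimT' dimT.
rewrite xgetPN// => _ [m dimT _].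
have indep := @orthonormal_lin_indep psi m.+1 (fun s t _ _ => ortho s t isT isT).
suff : (m < m)%N by rewrite ltnn.
apply: (lin_indep_le_dimension dimT indep) => j.
by exists (psi j) => //; exact: Tpsi.
Qed.

End dimension.

(** * Graded subspaces with positive defect and their models *)

Section model.
Set Implicit Arguments.
Unset Strict Implicit.
Local Open Scope complex_scope.
Context {R : realType} {k : nat} {n : 'I_k -> nat}.
Local Notation C := R[i].
Local Notation F := (fock R n).
Local Notation W := (word n).
Local Notation basis := (@Defs.basis R W).
Local Notation proj := Defs.proj.
Context (M : set F) (M_inv : invariant_subspace M).

Lemma homogeneous_orthogonal (d d' : 'I_k -> nat) (x y : F) :
  homogeneous_at d x -> homogeneous_at d' y -> d <> d' -> dot x y = 0.
Proof.
move=> dx dy dd'; rewrite -(dot0l (0 : F)) /dot; congr csum; apply/funext => w.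
rewrite [RHS]mul0r; have [->|xw] := eqVneq (x w) 0; first by rewrite mul0r.
have [->|yw] := eqVneq (y w) 0; first by rewrite rmorph0 mulr0.
by case: dd'; apply/funext => i; rewrite -(dx _ xw) (dy _ yw).
Qed.

Theorem model_of_graded_positive : graded M -> positive (defect M) ->
  exists (N : option nat) (psi : nat -> F), homogeneous_model M N psi.
Proof.
move=> gM posD; have [clM _] := M_inv.
have pM := proj_orth_projection clM.
have dM := graded_proj_degree clM gM.
pose Delta := partial_defect (index_enum 'I_k) (proj M).
have DE : defect M = Delta by exact: defectE.
have pD : orth_projection Delta.
  apply: orth_projection_partial_defect => // x _.
  by rewrite -/Delta -DE; exact: posD.
have dD : degree_preserving Delta.
  by apply: partial_defect_degree => //; exact: adjoint_linear pM.1.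
have linD := adjoint_linear pD.1.
pose V (d : 'I_k -> nat) := [set f : F | homogeneous_at d f /\ Delta f = f].
(* Enumerate the basis vectors; indices that are no code of a word give 0. *)
pose v l : F := if @choice.unpickle W l is Some u then Delta (basis u) else 0.
pose lab l : 'I_k -> nat :=
  if @choice.unpickle W l is Some u then fun i => size ((u : W) i) else fun=> 0%N.
have V0 d : V d 0 by split; [exact: homogeneous_at0|exact: lin0].
have VP d (z : C) x y : V d x -> V d y -> V d (z *: x + y).
  move=> [dx Dx] [dy Dy]; split; first exact: homogeneous_atP.
  by rewrite linD Dx Dy.
have Vorth d d' x y : V d x -> V d' y -> d <> d' -> dot x y = 0.
  by move=> [dx _] [dy _]; exact: homogeneous_orthogonal.
have Vv l : V (lab l) (v l).
  rewrite /V /v /lab /=; case: (choice.unpickle l) => [u|]; last exact: V0.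
  by split; [exact: dD|exact: pD.2].
have [N [psi [psiV ortho expand]]] := graded_gram_schmidt V0 VP Vorth Vv.
have hom s : index_lt s N -> exists d, homogeneous_at d (psi s).
  by move=> /psiV[d [dpsi _]]; exists d.
have fin s : index_lt s N -> finite_set (support (psi s)).
  by move=> /hom[d]; exact: homogeneous_finite.
have Dpsi s : index_lt s N -> Delta (psi s) = psi s.
  by move=> /psiV[d []].
have psiM s : index_lt s N -> M (psi s).
  by move=> sN; rewrite -Dpsi//; exact: partial_defect_mem.
exists N, psi; split=> [s sN|s sN|s sN|s t sN tN|x].
- by have [d /homogeneous_ofP] := hom s sN; exists d.
- by exists (psi s) => //; rewrite DE Dpsi.
- exact: (tilde_R_isometric fin ortho M_inv psiM hom pD Dpsi).
- exact: (tilde_R_orthogonal fin ortho M_inv psiM hom pD Dpsi).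
apply: (range_sum_cvg fin ortho M_inv psiM hom pD Dpsi) => u.
have [q qE] := expand (choice.pickle u); rewrite /v choice.pickleK in qE.
apply: cvg_near_cst; exists q => // m /= qm; rewrite -/Delta -(qE m qm).
by apply: eq_bigr => s sN; rewrite pD.1 Dpsi.
Qed.

Section from_model.
Context (N : option nat) (psi : nat -> F) (model : homogeneous_model M N psi).
Let clM : closed_subspace M. Proof. by case: M_inv. Qed.

Let model_hom s : index_lt s N -> exists d, homogeneous_at d (psi s).
Proof. by case: model => h _ _ _ _ /h[d /homogeneous_ofP]; exists d. Qed.

Let model_fin s : index_lt s N -> finite_set (support (psi s)).
Proof. by move=> /model_hom[d]; exact: homogeneous_finite. Qed.

Let model_nsq s x : index_lt s N -> nsq (tilde_R (psi s) x) = nsq x.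
Proof. by case: model => _ _ h _ _ /h/(_ x)/normH_eq. Qed.

Let model_ortho s t : index_lt s N -> index_lt t N ->
  dot (psi s) (psi t) = (s == t)%:R.
Proof.
move=> sN tN; rewrite -(tilde_R_vacuum (model_fin sN)) -(tilde_R_vacuum (model_fin tN)).
have [->|/eqP st] := eqVneq s t; first by rewrite dotxx model_nsq// nsq_basis.
by case: model => _ _ _ h _; exact: h.
Qed.

(** The defect is a finite combination of isometries and their adjoints around
    its argument, so it may be applied to the strongly convergent expansion of
    P term by term. *)
Lemma model_defect_expansion x :
  sums_to N (fun s => dot x (psi s) *: psi s) (defect M x).
Proof.
rewrite defectE; case: model => _ _ _ _ sumsP.
apply: cvg_ext (@partial_defect_cvg _ _ _ (index_enum 'I_k) _ _ sumsP x) => m.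
by rewrite [RHS](defect_range_sum model_fin).
Qed.

Lemma model_defect_fixes s : index_lt s N -> defect M (psi s) = psi s.
Proof.
move=> sN; apply: (sums_to_unique (@model_defect_expansion (psi s))).
apply: cvg_near_cst; exists s.+1 => // m /= sm.
rewrite (bigD1 (Ordinal sm))//= model_ortho// eqxx scale1r big1 ?addr0//.
move=> t /andP[tN ts].
by rewrite model_ortho// eq_sym -[_ == s]/(t == Ordinal sm) (negbTE ts) scale0r.
Qed.

(** Self-adjointness moves Delta onto the vectors psi_s, which it fixes, so
    Delta x and x have the same expansion. *)
Lemma model_defect_orth_projection : orth_projection (defect M).
Proof.
have DD : adjoint_pair (defect M) (defect M).
  rewrite defectE; apply: partial_defect_adjoint.
  exact: (proj_orth_projection clM).1.
split=> // x; apply: (sums_to_unique (@model_defect_expansion (defect M x))).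
apply: cvg_ext (@model_defect_expansion x) => m.
by apply: eq_bigr => s sN; rewrite DD model_defect_fixes.
Qed.

(** The range vector psi_s lies in M, hence so do the G_s e_w by invariance;
    as G_s is isometric and M closed, the whole range of G_s lies in M. *)
Lemma model_range_mem s x : index_lt s N -> M (tilde_R (psi s) x).
Proof.
move=> sN; have lT := tilde_R_linear (model_fin sN).
pose K := [set x | M (tilde_R (psi s) x)].
suff clK : closed_subspace K.
  apply: (basis_total clK) => w; apply: tilde_R_mem => //; first exact: model_fin.
  by rewrite -model_defect_fixes// defectE; exact: partial_defect_mem.
split.
- by rewrite /K /= (lin0 lT); exact: subspace0.
- move=> z y y' Ky Ky'; rewrite /K /= lT; apply: subspaceD => //.
  exact: subspaceZ.
- apply/closedHP => y yK; case: clM => _ _ /closedHP; apply => e /yK[y' Ky' yy'].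
  by exists (tilde_R (psi s) y') => //; rewrite -(linB lT) model_nsq.
Qed.

Lemma nsq_gauge lam (x : F) : nsq (gauge lam x) = nsq x.
Proof.
rewrite !nsq_psum; congr psum; apply/funext => w /=; rewrite normcM.
suff -> : normc (gauge_weight lam w) = 1 by rewrite mul1r.
apply: complexI; rewrite -[LHS]/`|gauge_weight lam w| normr_prod big1// => i _.
by rewrite normrX (eqP (valP (lam i))) expr1n.
Qed.

Theorem model_graded : graded M.
Proof.
move=> lam f Mf; rewrite -(proj_id clM Mf).
case: model => _ _ _ _ /(_ f) sumP.
have gsum : (fun m => gauge lam (\sum_(s < m | index_lt s N)
    tilde_R (psi s) (adj (tilde_R (psi s)) f))) @ \oo --> gauge lam (proj M f).
  apply: (@cvg_bounded _ _ _ 1) sumP => //; first exact: gauge_linear.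
  by move=> y; rewrite nsq_gauge mul1r.
apply: (subspace_lim clM _ gsum) => m.
rewrite (lin_sum (gauge_linear lam)); apply: subspace_sum => // s sN.
have [d dpsi] := model_hom sN; rewrite (gauge_tilde_R _ _ dpsi).
by apply: subspaceZ => //; exact: model_range_mem.
Qed.

Theorem model_positive : positive (defect M).
Proof.
move=> x; rewrite (orth_projection_dot _ model_defect_orth_projection).
by rewrite lecR nsq_ge0.
Qed.

Theorem model_rank : N = rank (defect M).
Proof.
apply: rank_orthonormal_expansion model_defect_expansion _ _.
- exact: model_ortho.
- exact: model_defect_fixes.
- exact: adjoint_linear model_defect_orth_projection.1.
Qed.

End from_model.
End model.

Theorem theorem3p2 (R : realType) (k : nat) (n : 'I_k -> nat)
    (k_gt0 : (0 < k)%N) (n_ge2 : forall i, (2 <= n i)%N)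
    (M : set (fock R n)) (M_inv : invariant_subspace M) :
  (graded M /\ positive (defect M) <->
   exists (N : option nat) (psi : nat -> fock R n),
     homogeneous_model M N psi) /\
  (forall (N : option nat) (psi : nat -> fock R n),
     homogeneous_model M N psi ->
     N = rank (defect M) /\
     forall xi : fock R n,
       sums_to N (fun s => dot xi (psi s) *: psi s) (defect M xi)).
Proof.
split=> [|N psi model].
  split=> [[gM posD]|[N [psi model]]]; first exact: model_of_graded_positive.
  by split; [exact: model_graded model|exact: model_positive model].
split; first exact: model_rank model.
exact: model_defect_expansion model.
Qed.
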